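(* Let $h>0$, $\Omega\in\mathbb{R}$, $g<0$ and $\mu>0$. Let $\phi(t)$ be the solution of the discrete Gross–Pitaevskii (DGPE) lattice $$i\dot{\phi}_n+\frac{1}{h^2}(\phi_{n+1}-2\phi_n+\phi_{n-1})-\Omega^2(hn)^2\phi_n-g|\phi_n|^2\phi_n=0,\quad n\in\mathbb{Z},$$ with initial condition $\phi(0)\in l^2$, and let $\psi(t)$ be the solution of the Ablowitz–Ladik (AL) lattice $$i\dot{\psi}_n+\frac{1}{h^2}(\psi_{n+1}-2\psi_n+\psi_{n-1})+\mu|\psi_n|^2(\psi_{n+1}+\psi_{n-1})=0,\quad n\in\mathbb{Z},$$ with initial condition $\psi(0)\in l^2_w=l^{2,2}$, both satisfying $\lim_{|n|\to\infty}\phi_n(t)=\lim_{|n|\to\infty}\psi_n(t)=0$ for all $t\ge0$. Let $y(t)=\phi(t)-\psi(t)$. Then there exist constants $C_{\mu,0}>0$ and $C^*_{\mu,0}>0$, independent of $t$ and of the initial data, such that: (i) for all $t\ge0$, $$\|y(t)\|_{l^2}\le\|y(0)\|_{l^2}+\mathcal{A}_1t+\mathcal{A}_2e^{\Gamma t},\qquad \mathcal{A}_1=|g|\,\|\phi(0)\|_{l^2}^3+2\mu C_{\mu,0}\|\psi(0)\|_{l^2}^3,\quad \mathcal{A}_2=\frac{\Omega^2}{\Gamma}\|\psi(0)\|_{l^2_w};$$ (ii) for all $t>0$, $\|y(t)\|_{l^2}\le\mathcal{B}[\phi(0),\psi(0)]:=\|\phi(0)\|_{l^2}+C^*_{\mu,0}\|\psi(0)\|_{l^2}$.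 In particular, the growing upper bound in (i) is relevant only on a finite interval $t\in[0,t^*]$ of times satisfying $\mathcal{A}_1t+\mathcal{A}_2e^{\Gamma t}\le\mathcal{B}-\|y(0)\|_{l^2}$.
   Context: $l^2$ is the space of complex sequences with $\|u\|_{l^2}^2=h\sum_{n\in\mathbb{Z}}|u_n|^2<\infty$; $l^2_w=l^{2,2}$ is the weighted space with $\|u\|_{l^2_w}^2=h\sum_n w_n|u_n|^2<\infty$, $w_n=(1+(hn)^2)^2$. Both problems are globally well-posed in $l^2$ (DGPE conserves $\|\phi(t)\|_{l^2}$), and AL solutions with $\psi(0)\in l^2$ satisfy $\|\psi(t)\|_{l^2}^2\le M_{\mu,0}\|\psi(0)\|_{l^2}^2$ for all $t>0$ with $M_{\mu,0}>0$ independent of $t$. The rate $\Gamma$ is $$\Gamma=\frac{2\sqrt{1+c_1+2c_1^{1/2}}}{h^2}+2\mu M_{\mu,0}\|\psi(0)\|_{l^2}^2,$$ where $c_1>0$ is a constant with $w_n\le c_1w_{n+1}$ for all $n$.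
   Formalization: The constants C and C* may depend on the bound M (and on h, Ω, g, μ), uniformly over all data sharing that M; constants fully independent of the initial data do not exist (moving AL solitons of growing amplitude). The closing remark on the interval [0,t*] is not stated. *)

(* Defs.v *)
From Stdlib Require Import Reals ZArith.
From Coquelicot Require Import Coquelicot.
Open Scope R_scope.

(** Sum over Z of a real family, enumerated as a(0)+a(-1) + a(1)+a(-2) + ... *)
Definition zterm (a : Z -> R) (k : nat) : R :=
  a (Z.of_nat k) + a (- Z.of_nat k - 1)%Z.
Definition zsummable (a : Z -> R) : Prop := ex_series (zterm a).
Definition zsum (a : Z -> R) : R := Series (zterm a).

Definition in_l2 (u : Z -> C) : Prop := zsummable (fun n => Cmod (u n) ^ 2).
Definition l2norm (h : R) (u : Z -> C) : R :=
  sqrt (h * zsum (fun n => Cmod (u n) ^ 2)).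

Definition wgt (h : R) (n : Z) : R := (1 + (h * IZR n) ^ 2) ^ 2.
Definition in_l2w (h : R) (u : Z -> C) : Prop :=
  zsummable (fun n => wgt h n * Cmod (u n) ^ 2).
Definition l2wnorm (h : R) (u : Z -> C) : R :=
  sqrt (h * zsum (fun n => wgt h n * Cmod (u n) ^ 2)).

Definition csub (u v : Z -> C) : Z -> C := fun n => (u n - v n)%C.

Definition vanishes_at_infinity (u : Z -> C) : Prop :=
  forall eps : R, 0 < eps -> exists N : Z,
    forall n : Z, (N <= Z.abs n)%Z -> Cmod (u n) < eps.

Definition is_lattice_solution (h : R) (F : (Z -> C) -> Z -> C)
    (u : R -> Z -> C) : Prop :=
  (forall t, 0 <= t -> in_l2 (u t)) /\
  (forall t, 0 <= t ->
     filterlim (fun s => l2norm h (csub (u s) (u t)))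
               (within (fun s => 0 <= s) (locally t)) (locally 0)) /\
  (forall t, 0 < t -> forall n : Z, exists d : C,
     is_derive (fun s => u s n) t d /\ (Ci * d + F (u t) n)%C = 0%C) /\
  (forall t, 0 <= t -> vanishes_at_infinity (u t)).

Definition dlap (h : R) (u : Z -> C) (n : Z) : C :=
  (RtoC (/ h ^ 2) * (u (n + 1)%Z - RtoC 2 * u n + u (n - 1)%Z))%C.

Definition F_DGPE (h Om g : R) (u : Z -> C) (n : Z) : C :=
  (dlap h u n - RtoC (Om ^ 2 * (h * IZR n) ^ 2) * u n
     - RtoC (g * Cmod (u n) ^ 2) * u n)%C.

Definition F_AL (h mu : R) (u : Z -> C) (n : Z) : C :=
  (dlap h u n + RtoC (mu * Cmod (u n) ^ 2) * (u (n + 1)%Z + u (n - 1)%Z))%C.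

Definition Gamma_rate (h mu c1 M : R) (psi0 : Z -> C) : R :=
  2 * sqrt (1 + c1 + 2 * sqrt c1) / h ^ 2 + 2 * mu * M * (l2norm h psi0) ^ 2.

(* Main.v *)
Require Import Defs.
From Stdlib Require Import Reals ZArith Lra Lia.
From Coquelicot Require Import Coquelicot.
Open Scope R_scope.

(** Both lattices and their difference [y] have the form [i z' + Delta z = rho z + q] with a real
    potential [rho], so that [|z_n|^2] changes only by the divergence of the current
    [Im (conj z_n z_(n+1))] and by the source [q].  Differentiating
    [sum_n chi_N(n) v_n |z_n|^2] with the linear cutoff [chi_N(n) = max (0, 1 - |n| / (N + 1))]
    involves finite sums only, and the cutoff error is O(1/N).  This gives norm bounds for [phi]
    ([q = 0]), for [psi] in the weighted space (with [v = min (w, R)] and R arbitrary),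
    and for [y].

    With the norms of the theorem, [|u_n|^2 <= ||u||^2 / h], so for h < 1 a direct estimate of
    the cubic terms loses a factor [1 / h], and the nonlinear growth rate of the weighted norm
    of [psi] need not be below [Gamma].  Both losses are absorbed in [C_mu].  In the DGPE term only
    [|g| |phi|^2 |psi|] acts as a source, which a weighted AM-GM inequality bounds by
    [|g| ||phi||^3 + C ||psi||^3].  For [t] up to a constant over [||psi(0)||^2] the nonlinear
    growth of the weighted norm is at most a factor 2, whereas its linear rate
    [sqrt c_1 / h^2] is below [Gamma / 2], and [4 (e^(Gamma t / 2) - 1) <= e^(Gamma t)].
    For later times [C_mu ||psi(0)||^3 t] exceeds the uniform bound (ii). *)

(** * Windowed sums and l2 norms *)

Fixpoint block (a : Z -> R) (lo : Z) (m : nat) : R :=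
  match m with
  | O => 0
  | S m' => block a lo m' + a (lo + Z.of_nat m')%Z
  end.

(** The asymmetric range from -N-1 to N consists of the indices visited by the first N+1 terms of
    [zterm], so that windows are exactly the partial sums of [zsum]. *)
Definition window (N : nat) (a : Z -> R) : R :=
  block a (- Z.of_nat N - 1) (2 * N + 2).

Lemma block_ext a b lo m :
  (forall n, a n = b n) -> block a lo m = block b lo m.
Proof. intros H; induction m; simpl; congruence. Qed.

Lemma block_plus a b lo m :
  block (fun n => a n + b n) lo m = block a lo m + block b lo m.
Proof. induction m; simpl; lra. Qed.

Lemma block_scal c a lo m :
  block (fun n => c * a n) lo m = c * block a lo m.
Proof. induction m; simpl; lra. Qed.

Lemma block_le a b lo m :
  (forall n, (lo <= n < lo + Z.of_nat m)%Z -> a n <= b n) ->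
  block a lo m <= block b lo m.
Proof.
  induction m as [|m IH]; intros H; simpl; [lra|].
  apply Rplus_le_compat; [apply IH; intros|]; apply H; lia.
Qed.

Lemma block_pos a lo m : (forall n, 0 <= a n) -> 0 <= block a lo m.
Proof. intros H; induction m; simpl; [lra | specialize (H (lo + Z.of_nat m)%Z); lra]. Qed.

(** The sum telescopes; every boundary term in the later summations by parts comes from here. *)
Lemma block_shift a lo m :
  block (fun n => a (n + 1)%Z) lo m = block a lo m + a (lo + Z.of_nat m)%Z - a lo.
Proof.
  induction m as [|m IH].
  - simpl. rewrite Z.add_0_r. lra.
  - cbn [block]. rewrite IH.
    replace (lo + Z.of_nat m + 1)%Z with (lo + Z.of_nat (S m))%Z by lia. lra.
Qed.

Lemma block_first a lo m : block a lo (S m) = a lo + block a (lo + 1) m.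
Proof.
  induction m as [|m IH].
  - simpl. rewrite Z.add_0_r. lra.
  - change (block a lo (S (S m))) with (block a lo (S m) + a (lo + Z.of_nat (S m))%Z).
    rewrite IH. cbn [block].
    replace (lo + 1 + Z.of_nat m)%Z with (lo + Z.of_nat (S m))%Z by lia. lra.
Qed.

Lemma window_zterm a N : window N a = sum_n (zterm a) N.
Proof.
  unfold window. induction N as [|N IH].
  - rewrite sum_O. unfold zterm. simpl. lra.
  - rewrite sum_Sn, <- IH. change plus with Rplus.
    replace (2 * S N + 2)%nat with (S (S (2 * N + 2))) by lia.
    cbn [block].
    replace (- Z.of_nat (S N) - 1 + Z.of_nat (S (2 * N + 2)))%Z with (Z.of_nat (S N)) by lia.
    pose proof (block_first a (- Z.of_nat (S N) - 1) (2 * N + 2)) as E.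
    cbn [block] in E.
    replace (- Z.of_nat (S N) - 1 + 1)%Z with (- Z.of_nat N - 1)%Z in E by lia.
    unfold zterm.
    change (Z.neg (Pos.of_succ_nat N)) with (- Z.of_nat (S N))%Z.
    change (Z.pos (Pos.of_succ_nat N)) with (Z.of_nat (S N))%Z. lra.
Qed.

Lemma zterm_pos a k : (forall n, 0 <= a n) -> 0 <= zterm a k.
Proof.
  intros H; unfold zterm.
  pose proof (H (Z.of_nat k)); pose proof (H (- Z.of_nat k - 1)%Z); lra.
Qed.

Lemma window_mono a m N :
  (forall n, 0 <= a n) -> (m <= N)%nat -> window m a <= window N a.
Proof.
  intros H L; induction L as [|N L IH]; [lra|].
  rewrite (window_zterm a (S N)), sum_Sn, <- window_zterm.
  pose proof (zterm_pos a (S N) H). unfold plus; simpl; lra.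
Qed.

Lemma window_le_zsum a N :
  (forall n, 0 <= a n) -> zsummable a -> window N a <= zsum a.
Proof.
  intros H S. rewrite window_zterm.
  apply (is_lim_seq_incr_compare (sum_n (zterm a))).
  - exact (Series_correct _ S).
  - intros k. rewrite sum_Sn. pose proof (zterm_pos a (Datatypes.S k) H).
    unfold plus; simpl; lra.
Qed.

(** Monotone convergence of the partial sums; it turns estimates uniform in the window into l2
    membership together with a norm bound. *)
Lemma bounded_window_summable a B :
  (forall n, 0 <= a n) -> (forall N, window N a <= B) ->
  zsummable a /\ zsum a <= B.
Proof.
  intros H HB.
  assert (S : zsummable a).
  { destruct (ex_finite_lim_seq_incr (sum_n (zterm a)) B) as [l Hl].
    - intros k. rewrite <- !window_zterm. apply window_mono; auto.
    - intros k. rewrite <- window_zterm. apply HB.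
    - exists l. exact Hl. }
  split; [exact S|].
  apply (is_lim_seq_le (sum_n (zterm a)) (fun _ => B) (zsum a) B).
  - intros k. rewrite <- window_zterm. apply HB.
  - exact (Series_correct _ S).
  - apply is_lim_seq_const.
Qed.

(** Weighted Cauchy-Schwarz from AM-GM with ratio B/A. Since [A] or [B] may vanish, both are first
    raised by [e > 0]. *)
Lemma block_CS c a b lo m A B :
  (forall n, 0 <= c n) -> 0 <= A -> 0 <= B ->
  block (fun n => c n * a n ^ 2) lo m <= A ^ 2 ->
  block (fun n => c n * b n ^ 2) lo m <= B ^ 2 ->
  block (fun n => c n * (a n * b n)) lo m <= A * B.
Proof.
  intros Hc HA HB Ha Hb.
  assert (K : forall e, 0 < e ->
    block (fun n => c n * (a n * b n)) lo m <= (A + e) * (B + e)).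
  { intros e He.
    set (A' := A + e). set (B' := B + e).
    assert (0 < A') by (unfold A'; lra). assert (0 < B') by (unfold B'; lra).
    apply Rle_trans with
      (block (fun n => B' / (2 * A') * (c n * a n ^ 2) + A' / (2 * B') * (c n * b n ^ 2)) lo m).
    - apply block_le. intros n _.
      replace (B' / (2 * A') * (c n * a n ^ 2) + A' / (2 * B') * (c n * b n ^ 2))
        with (c n * (a n * b n) + c n * (A' * B' / 2 * (a n / A' - b n / B') ^ 2))
        by (field; lra).
      assert (0 <= A' * B' / 2 * (a n / A' - b n / B') ^ 2).
      { apply Rmult_le_pos; [nra | apply pow2_ge_0]. }
      specialize (Hc n). nra.
    - rewrite block_plus, !block_scal.
      assert (Ha' : block (fun n => c n * a n ^ 2) lo m <= A' ^ 2) by (unfold A'; nra).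
      assert (Hb' : block (fun n => c n * b n ^ 2) lo m <= B' ^ 2) by (unfold B'; nra).
      replace (A' * B') with (B' / (2 * A') * A' ^ 2 + A' / (2 * B') * B' ^ 2) by (field; lra).
      apply Rplus_le_compat; apply Rmult_le_compat_l; auto;
        apply Rlt_le, Rdiv_lt_0_compat; lra. }
  apply Rnot_lt_le; intros L.
  set (S := block (fun n => c n * (a n * b n)) lo m) in *.
  (* As [e <= 1], the excess of [(A + e) * (B + e)] over [A * B] is at most [e * (A + B + 1)], hence
     at most half of [S - A * B]. *)
  set (e := Rmin 1 ((S - A * B) / (2 * (A + B + 1)))).
  assert (He : 0 < e).
  { apply Rmin_glb_lt; [lra|]. apply Rdiv_lt_0_compat; lra. }
  assert (e <= 1) by apply Rmin_l.
  assert (e * (2 * (A + B + 1)) <= S - A * B).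
  { apply Rle_trans with ((S - A * B) / (2 * (A + B + 1)) * (2 * (A + B + 1))).
    - apply Rmult_le_compat_r; [lra | apply Rmin_r].
    - right; field; lra. }
  specialize (K e He). nra.
Qed.

Lemma block_term a lo m n :
  (forall n, 0 <= a n) -> (lo <= n < lo + Z.of_nat m)%Z -> a n <= block a lo m.
Proof.
  intros H; induction m as [|m IH]; intros L; [lia|]. cbn [block].
  destruct (Z.eq_dec n (lo + Z.of_nat m)) as [->|D].
  - pose proof (block_pos a lo m H); lra.
  - pose proof (H (lo + Z.of_nat m)%Z). assert (a n <= block a lo m) by (apply IH; lia). lra.
Qed.

Lemma term_le_window a N n :
  (forall n, 0 <= a n) -> (Z.abs n <= Z.of_nat N)%Z -> a n <= window N a.
Proof. intros H L. apply block_term; auto; lia. Qed.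

Lemma term_le_zsum a n : (forall n, 0 <= a n) -> zsummable a -> a n <= zsum a.
Proof.
  intros H S. apply Rle_trans with (window (Z.abs_nat n) a).
  - apply term_le_window; auto; lia.
  - apply window_le_zsum; auto.
Qed.

(** Removes the regularisation [e] in [flow_l2_growth]: for [e <= 1] the square grows by at most
    [e * (2 * (b + c) + 1)]. *)
Lemma sqr_le_of_le_add a b c :
  0 <= b -> 0 <= c -> (forall e, 0 < e -> a <= (b + c + e) ^ 2) -> a <= (b + c) ^ 2.
Proof.
  intros Hb Hc H. apply Rnot_lt_le; intros L.
  set (d := a - (b + c) ^ 2) in *.
  set (e := Rmin 1 (d / (2 * (2 * (b + c) + 1)))).
  assert (Hd : 0 < d) by (unfold d; lra).
  assert (He : 0 < e).
  { apply Rmin_glb_lt; [lra|]. apply Rdiv_lt_0_compat; lra. }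
  assert (e <= 1) by apply Rmin_l.
  assert (e * (2 * (2 * (b + c) + 1)) <= d).
  { apply Rle_trans with (d / (2 * (2 * (b + c) + 1)) * (2 * (2 * (b + c) + 1))).
    - apply Rmult_le_compat_r; [lra | apply Rmin_r].
    - right; field; lra. }
  specialize (H e He). unfold d in *. nra.
Qed.

Lemma l2norm_ge_0 h u : 0 <= l2norm h u.
Proof. apply sqrt_pos. Qed.

Lemma pow2_Cmod_ge_0 (u : Z -> C) n : 0 <= Cmod (u n) ^ 2.
Proof. apply pow2_ge_0. Qed.

Lemma zsum_pos a : (forall n, 0 <= a n) -> zsummable a -> 0 <= zsum a.
Proof. intros H S. pose proof (H 0%Z). pose proof (term_le_zsum a 0 H S). lra. Qed.

(** Allows the estimates to run in the norm without the factor h, which is restored at the end. *)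
Lemma l2norm_scale h u : 0 < h -> l2norm h u = sqrt h * l2norm 1 u.
Proof. intros H. unfold l2norm. rewrite Rmult_1_l. now rewrite sqrt_mult_alt by lra. Qed.

Lemma l2norm1_sqr u : in_l2 u -> l2norm 1 u ^ 2 = zsum (fun n => Cmod (u n) ^ 2).
Proof.
  intros H. unfold l2norm. rewrite Rmult_1_l. apply pow2_sqrt.
  apply zsum_pos; [apply pow2_Cmod_ge_0 | exact H].
Qed.

Lemma window_le_l2norm1 u N :
  in_l2 u -> window N (fun n => Cmod (u n) ^ 2) <= l2norm 1 u ^ 2.
Proof.
  intros H. rewrite l2norm1_sqr by auto.
  apply window_le_zsum; [apply pow2_Cmod_ge_0 | exact H].
Qed.

Lemma Cmod_sqr_le_l2norm1 u n : in_l2 u -> Cmod (u n) ^ 2 <= l2norm 1 u ^ 2.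
Proof.
  intros H. rewrite l2norm1_sqr by auto.
  apply (term_le_zsum (fun n => Cmod (u n) ^ 2)); [apply pow2_Cmod_ge_0 | exact H].
Qed.

Lemma l2norm1_le u B :
  0 <= B -> (forall N, window N (fun n => Cmod (u n) ^ 2) <= B ^ 2) ->
  in_l2 u /\ l2norm 1 u <= B.
Proof.
  intros HB H.
  destruct (bounded_window_summable (fun n => Cmod (u n) ^ 2) (B ^ 2)) as [S L]; auto.
  { apply pow2_Cmod_ge_0. }
  split; [exact S|]. unfold l2norm. rewrite Rmult_1_l.
  rewrite <- (sqrt_pow2 B HB). now apply sqrt_le_1_alt.
Qed.

(** Minkowski's inequality, from Cauchy-Schwarz on each window. The hypothesis concerns moduli only,
    so it covers both the direct and the reverse triangle inequality. *)
Lemma l2_triangle u v w :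
  (forall n, Cmod (w n) <= Cmod (u n) + Cmod (v n)) -> in_l2 u -> in_l2 v ->
  in_l2 w /\ l2norm 1 w <= l2norm 1 u + l2norm 1 v.
Proof.
  intros H Hu Hv.
  pose proof (l2norm_ge_0 1 u). pose proof (l2norm_ge_0 1 v).
  apply l2norm1_le; [lra|]. intros N.
  pose proof (window_le_l2norm1 u N Hu) as Wu.
  pose proof (window_le_l2norm1 v N Hv) as Wv.
  assert (CS : window N (fun n => 1 * (Cmod (u n) * Cmod (v n))) <= l2norm 1 u * l2norm 1 v).
  { apply block_CS; auto; [intros; lra| |];
      (erewrite block_ext; [eassumption | intros n; simpl; ring]). }
  apply Rle_trans with (window N (fun n =>
    (Cmod (u n) ^ 2 + Cmod (v n) ^ 2) + 2 * (1 * (Cmod (u n) * Cmod (v n))))).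
  - apply block_le. intros n _. specialize (H n). pose proof (Cmod_ge_0 (w n)). nra.
  - unfold window in *. rewrite !block_plus, (block_scal 2). nra.
Qed.

Lemma csub_triangle u v :
  in_l2 u -> in_l2 v ->
  in_l2 (csub u v) /\ l2norm 1 (csub u v) <= l2norm 1 u + l2norm 1 v.
Proof.
  intros Hu Hv. apply l2_triangle; auto. intros n. unfold csub, Cminus.
  eapply Rle_trans; [apply Cmod_triangle|]. rewrite Cmod_opp. lra.
Qed.

Lemma l2norm1_sub_le u v :
  in_l2 u -> in_l2 v -> l2norm 1 u <= l2norm 1 v + l2norm 1 (csub u v).
Proof.
  intros Hu Hv. apply l2_triangle; auto; [|now apply csub_triangle].
  intros n. unfold csub. eapply Rle_trans; [|apply Cmod_triangle].
  right. f_equal. ring.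
Qed.

Lemma l2norm1_csub_sym u v : l2norm 1 (csub u v) = l2norm 1 (csub v u).
Proof.
  unfold l2norm. do 2 f_equal. apply Series_ext. intros k. unfold zterm, csub.
  f_equal; rewrite <- Cmod_opp; do 2 f_equal; ring.
Qed.

(** * The linear cutoff and its removal *)

Definition cutoff (N : nat) (n : Z) : R := Rmax 0 (1 - IZR (Z.abs n) / (INR N + 1)).

Lemma cutoff_bounds N n : 0 <= cutoff N n <= 1.
Proof.
  unfold cutoff. split; [apply Rmax_l|]. apply Rmax_lub; [lra|].
  pose proof (pos_INR N).
  assert (0 <= IZR (Z.abs n) / (INR N + 1)).
  { apply Rdiv_le_0_compat; [|lra]. apply IZR_le. lia. }
  lra.
Qed.

Lemma cutoff_end N n : (Z.of_nat N + 1 <= Z.abs n)%Z -> cutoff N n = 0.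
Proof.
  intros H. unfold cutoff. apply Rmax_left.
  pose proof (pos_INR N). apply IZR_le in H.
  rewrite plus_IZR, <- INR_IZR_INZ in H.
  apply (Rmult_le_reg_r (INR N + 1)); [lra|].
  replace ((1 - IZR (Z.abs n) / (INR N + 1)) * (INR N + 1)) with (INR N + 1 - IZR (Z.abs n))
    by (field; lra). lra.
Qed.

(** The absolute value and the maximum with 0 are 1-Lipschitz. This slope is the source of the
    O(1/N) cutoff errors. *)
Lemma cutoff_step N n : Rabs (cutoff N (n + 1) - cutoff N n) <= / (INR N + 1).
Proof.
  pose proof (pos_INR N).
  assert (Hinv : 0 < / (INR N + 1)) by (apply Rinv_0_lt_compat; lra).
  assert (Habs : - 1 <= IZR (Z.abs (n + 1)) - IZR (Z.abs n) <= 1).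
  { rewrite <- minus_IZR. split; apply IZR_le; lia. }
  unfold cutoff, Rdiv. set (i := / (INR N + 1)) in *.
  assert (- i <= IZR (Z.abs (n + 1)) * i - IZR (Z.abs n) * i <= i) by nra.
  unfold Rmax. apply Rabs_le.
  repeat destruct Rle_dec; lra.
Qed.

(** On a fixed window the cutoff differs from 1 by O(1/N), an error of the same order as the allowed
    [D / (INR N + 1)]; both disappear as N grows. *)
Lemma cutoff_limit a B D :
  (forall n, 0 <= a n) ->
  (forall N, window N (fun n => cutoff N n * a n) <= B + D / (INR N + 1)) ->
  forall m, window m a <= B.
Proof.
  intros Ha H m.
  set (W := window m a).
  assert (HW : 0 <= W) by (apply block_pos; auto).
  (* The [INR m + 1] reflects the leftmost site -m-1 of the window, where the cutoff is smallest. *)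
  assert (K : forall N, (m <= N)%nat -> W - B <= (D + W * (INR m + 1)) * / (INR N + 1)).
  { intros N L. specialize (H N). pose proof (pos_INR N). pose proof (pos_INR m).
    assert (Hc : (1 - (INR m + 1) / (INR N + 1)) * W <= window N (fun n => cutoff N n * a n)).
    { apply Rle_trans with (window m (fun n => cutoff N n * a n)).
      - unfold W, window. rewrite <- block_scal. apply block_le. intros n Hn.
        apply Rmult_le_compat_r; auto.
        unfold cutoff. eapply Rle_trans; [|apply Rmax_r].
        apply Rplus_le_compat_l, Ropp_le_contravar. unfold Rdiv.
        apply Rmult_le_compat_r; [apply Rlt_le, Rinv_0_lt_compat; lra|].
        rewrite INR_IZR_INZ, <- plus_IZR. apply IZR_le. lia.
      - apply window_mono; auto. intros n. apply Rmult_le_pos; auto.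
        apply cutoff_bounds. }
    unfold Rdiv in *. nra. }
  apply Rnot_lt_le; intros L.
  set (E := Rabs (D + W * (INR m + 1))).
  destruct (INR_unbounded (E / (W - B))) as [N HN].
  specialize (K (N + m)%nat ltac:(lia)).
  rewrite plus_INR in K. pose proof (pos_INR N). pose proof (pos_INR m).
  assert (E < INR N * (W - B)).
  { apply (Rmult_lt_compat_r (W - B)) in HN; [|lra].
    unfold Rdiv in HN. rewrite Rmult_assoc, Rinv_l, Rmult_1_r in HN; lra. }
  apply (Rmult_le_compat_r (INR N + INR m + 1)) in K; [|lra].
  rewrite Rmult_assoc, Rinv_l, Rmult_1_r in K by lra.
  pose proof (Rle_abs (D + W * (INR m + 1))). unfold E in *. nra.
Qed.

(** * Discrete Schrodinger flows *)

(** The equations hold only for t > 0 and solutions are controlled only for t >= 0, so at time zero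
    only a one-sided limit is available. *)
Definition right_continuous_0 (f : R -> R) : Prop :=
  filterlim f (at_right 0) (locally (f 0)).

Lemma right_continuous_0_plus f g :
  right_continuous_0 f -> right_continuous_0 g -> right_continuous_0 (fun s => f s + g s).
Proof.
  intros Hf Hg.
  exact (filterlim_comp_2 f g _ Hf Hg (@filterlim_plus R_AbsRing R_NormedModule (f 0) (g 0))).
Qed.

Lemma right_continuous_0_mult f g :
  right_continuous_0 f -> right_continuous_0 g -> right_continuous_0 (fun s => f s * g s).
Proof.
  intros Hf Hg.
  exact (filterlim_comp_2 f g _ Hf Hg (@filterlim_mult R_AbsRing (f 0) (g 0))).
Qed.

Lemma right_continuous_0_comp f g :
  right_continuous_0 f -> continuous g (f 0) -> right_continuous_0 (fun s => g (f s)).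
Proof. intros Hf Hg. exact (filterlim_comp _ _ _ _ _ _ _ _ Hf Hg). Qed.

Lemma ex_derive_right_continuous_0 f : ex_derive f 0 -> right_continuous_0 f.
Proof.
  intros H. apply filterlim_filter_le_1 with (2 := ex_derive_continuous f 0 H).
  apply filter_le_within.
Qed.

(** If [f T] exceeded [f 0], right continuity would give a small [x > 0] with [f x < f T], against
    the mean value theorem on [x, T]. *)
Lemma nonincreasing_from_0 (f df : R -> R) T :
  0 < T ->
  (forall x, 0 < x <= T -> is_derive f x (df x)) ->
  (forall x, 0 < x <= T -> df x <= 0) ->
  right_continuous_0 f ->
  f T <= f 0.
Proof.
  intros HT Hd Hneg Hlim. apply Rnot_lt_le; intros L.
  assert (He : 0 < f T - f 0) by lra.
  specialize (Hlim (ball (f 0) (mkposreal _ He)) (locally_ball _ _)).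
  destruct Hlim as [d Hdel].
  pose proof (cond_pos d) as Hdpos.
  set (x := Rmin (d / 2) (T / 2)).
  assert (Hx : 0 < x) by (apply Rmin_glb_lt; lra).
  assert (x <= d / 2) by apply Rmin_l. assert (x <= T / 2) by apply Rmin_r.
  assert (B : ball 0 d x).
  { unfold ball; simpl; unfold AbsRing_ball, abs, minus, plus, opp; simpl.
    apply Rabs_def1; lra. }
  specialize (Hdel x B Hx). unfold ball in Hdel; simpl in Hdel.
  unfold AbsRing_ball, abs, minus, plus, opp in Hdel; simpl in Hdel.
  apply Rabs_def2 in Hdel.
  destruct (MVT_gen f x T df) as [c [Hc E]].
  - intros y. rewrite Rmin_left, Rmax_right by lra. intros; apply Hd; lra.
  - intros y. rewrite Rmin_left, Rmax_right by lra. intros.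
    apply derivable_continuous_pt. exists (df y).
    apply is_derive_Reals. apply Hd; lra.
  - rewrite Rmin_left, Rmax_right in Hc by lra.
    assert (df c <= 0) by (apply Hneg; lra). nra.
Qed.

Lemma Cmod_sqr (z : C) : Cmod z ^ 2 = fst z ^ 2 + snd z ^ 2.
Proof. unfold Cmod. apply pow2_sqrt. nra. Qed.

(** This is Im (conj u v): the current when taken at neighbouring sites, the rate of mass gain when
    [v] is the source. *)
Definition cross (u v : C) : R := fst u * snd v - snd u * fst v.

(** Lagrange's identity: the squares of the real and imaginary parts of conj u v add up to |u|^2
    |v|^2. *)
Lemma Rabs_cross_le u v : Rabs (cross u v) <= Cmod u * Cmod v.
Proof.
  rewrite <- (Rabs_pos_eq (Cmod u * Cmod v))
    by (apply Rmult_le_pos; apply Cmod_ge_0).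
  apply Rsqr_le_abs_0. unfold Rsqr, cross.
  pose proof (Cmod_sqr u). pose proof (Cmod_sqr v).
  replace (Cmod u * Cmod v * (Cmod u * Cmod v)) with (Cmod u ^ 2 * Cmod v ^ 2) by ring.
  rewrite H, H0. pose proof (pow2_ge_0 (fst u * fst v + snd u * snd v)). nra.
Qed.

Lemma cross_le u v : cross u v <= Cmod u * Cmod v.
Proof. eapply Rle_trans; [apply Rle_abs | apply Rabs_cross_le]. Qed.

(** Nonlinear terms enter as given time-dependent coefficients [rho] and [q]. Continuity at 0 is
    asked of the squared moduli, which are what the energies are made of. *)
Definition schrodinger_flow (h : R) (rho : R -> Z -> R) (q : R -> Z -> C)
    (z : R -> Z -> C) : Prop :=
  (forall t, 0 < t -> forall n : Z, exists d : C,
     is_derive (fun s => z s n) t d /\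
     (Ci * d + (dlap h (z t) n - RtoC (rho t n) * z t n - q t n))%C = 0%C) /\
  (forall n, right_continuous_0 (fun s => Cmod (z s n) ^ 2)).

Lemma is_derive_components (u : R -> C) t (d : C) :
  is_derive u t d ->
  is_derive (fun s => fst (u s)) t (fst d) /\ is_derive (fun s => snd (u s)) t (snd d).
Proof.
  intros H; split.
  - apply (filterdiff_ext_lin _ (fun y : R => fst (scal y d))); [|reflexivity].
    apply (filterdiff_comp u (@fst R R) (fun y : R => scal y d) (@fst R R)); [exact H|].
    apply filterdiff_linear, is_linear_fst.
  - apply (filterdiff_ext_lin _ (fun y : R => snd (scal y d))); [|reflexivity].
    apply (filterdiff_comp u (@snd R R) (fun y : R => scal y d) (@snd R R)); [exact H|].
    apply filterdiff_linear, is_linear_snd.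
Qed.

(** Multiply the equation by conj z_n and take imaginary parts: the real potential and the diagonal
    of the Laplacian drop out. *)
Lemma is_derive_Cmod_sqr h rho q z t n :
  schrodinger_flow h rho q z -> 0 < t ->
  is_derive (fun s => Cmod (z s n) ^ 2) t
    (- (2 / h ^ 2) * (cross (z t n) (z t (n + 1)%Z)
                      - cross (z t (n - 1)%Z) (z t n))
     + 2 * cross (z t n) (q t n)).
Proof.
  intros [H _] Ht. destruct (H t Ht n) as [d [Hd E]].
  destruct (is_derive_components _ _ _ Hd) as [H1 H2].
  apply (is_derive_ext (fun s => fst (z s n) ^ 2 + snd (z s n) ^ 2)).
  { intros s. symmetry. apply Cmod_sqr. }
  replace (- (2 / h ^ 2) * (cross (z t n) (z t (n + 1)%Z)
                      - cross (z t (n - 1)%Z) (z t n)) + 2 * cross (z t n) (q t n))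
    with (INR 2 * fst d * fst (z t n) ^ 1 + INR 2 * snd d * snd (z t n) ^ 1).
  - refine (is_derive_plus _ _ _ _ _ _ _); apply is_derive_pow; assumption.
  - unfold dlap in E. unfold cross.
    pose proof (f_equal fst E) as E1. pose proof (f_equal snd E) as E2.
    unfold Rdiv. set (k := / h ^ 2) in *. clearbody k.
    destruct (z t n) as [a b], (z t (n + 1)%Z) as [ap bp], (z t (n - 1)%Z) as [am bm],
      (q t n) as [q1 q2], d as [d1 d2].
    simpl in *.
    (* The real part of the equation determines [d2], the imaginary part [d1]. *)
    assert (d2 = k * (ap - 2 * a + am) - rho t n * a - q1) as -> by lra.
    assert (d1 = - (k * (bp - 2 * b + bm) - rho t n * b - q2)) as -> by lra.
    ring.
Qed.

Lemma is_derive_block (f : R -> Z -> R) (df : Z -> R) t lo m :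
  (forall n, is_derive (fun s => f s n) t (df n)) ->
  is_derive (fun s => block (f s) lo m) t (block df lo m).
Proof.
  intros H; induction m as [|m IH]; simpl.
  - refine (is_derive_const _ _).
  - refine (is_derive_plus _ _ _ _ _ _ _); auto.
Qed.

Lemma right_continuous_0_block (f : R -> Z -> R) lo m :
  (forall n, right_continuous_0 (fun s => f s n)) ->
  right_continuous_0 (fun s => block (f s) lo m).
Proof.
  intros H; induction m as [|m IH]; simpl.
  - apply filterlim_const.
  - now apply right_continuous_0_plus.
Qed.

(** * Localised energies and their growth *)

Definition energy (N : nat) (V : Z -> R) (u : Z -> C) : R :=
  window N (fun n => V n * Cmod (u n) ^ 2).

(* Abel summation moves the discrete divergence of the current
   [cross (z n) (z (n + 1))] onto the weight. *)
Lemma is_derive_energy h rho q z t N V :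
  schrodinger_flow h rho q z -> 0 < t ->
  V (- Z.of_nat N - 1)%Z = 0 -> V (Z.of_nat N + 1)%Z = 0 ->
  is_derive (fun s => energy N V (z s)) t
    (2 / h ^ 2 * window N (fun n => (V (n + 1)%Z - V n) * cross (z t n) (z t (n + 1)%Z))
     + 2 * window N (fun n => V n * cross (z t n) (q t n))).
Proof.
  intros H Ht V0 V1.
  set (J := fun n => cross (z t n) (z t (n + 1)%Z)).
  set (b := fun n => V n * J (n - 1)%Z).
  set (d := fun n => V n * (- (2 / h ^ 2) * (cross (z t n) (z t (n + 1)%Z)
                      - cross (z t (n - 1)%Z) (z t n)) + 2 * cross (z t n) (q t n))).
  replace (_ + _) with (window N d).
  - apply is_derive_block. intros n.
    apply (is_derive_scal (fun s => Cmod (z s n) ^ 2)).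
    now apply (is_derive_Cmod_sqr h rho q).
  - unfold window.
    (* [b] carries the current entering from the left; it vanishes with [V] at the two end sites, so
       shifting it leaves no boundary term. *)
    pose proof (block_shift b (- Z.of_nat N - 1) (2 * N + 2)) as T.
    assert (b (- Z.of_nat N - 1)%Z = 0) by (unfold b; rewrite V0; ring).
    assert (b (- Z.of_nat N - 1 + Z.of_nat (2 * N + 2))%Z = 0).
    { unfold b. replace (- Z.of_nat N - 1 + Z.of_nat (2 * N + 2))%Z
        with (Z.of_nat N + 1)%Z by lia. rewrite V1; ring. }
    rewrite (block_ext d (fun n => - (2 / h ^ 2) * b (n + 1)%Z + (2 / h ^ 2 * b n +
      (2 / h ^ 2 * ((V (n + 1)%Z - V n) * cross (z t n) (z t (n + 1)%Z))
       + 2 * (V n * cross (z t n) (q t n)))))).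
    + rewrite !block_plus, !block_scal. rewrite T, H0, H1. ring.
    + intros n. unfold d, b, J.
      replace (n + 1 - 1)%Z with n by lia. replace (n - 1 + 1)%Z with n by lia. ring.
Qed.

Lemma right_continuous_0_energy h rho q z N V :
  schrodinger_flow h rho q z -> right_continuous_0 (fun s => energy N V (z s)).
Proof.
  intros [_ H]. apply (right_continuous_0_block (fun s n => V n * Cmod (z s n) ^ 2)).
  intros n. apply right_continuous_0_mult; [apply filterlim_const | apply H].
Qed.

(** The shift brings in the single new site N+1, whose term is itself at most [B]; hence the factor
    2. *)
Lemma window_shift_le a B N :
  (forall n, 0 <= a n) -> (forall N, window N a <= B) ->
  window N (fun n => a (n + 1)%Z) <= 2 * B.
Proof.
  intros Ha HB. unfold window. rewrite block_shift.
  replace (- Z.of_nat N - 1 + Z.of_nat (2 * N + 2))%Z with (Z.of_nat N + 1)%Z by lia.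
  pose proof (HB N) as H1. unfold window in H1.
  assert (a (Z.of_nat N + 1)%Z <= B).
  { eapply Rle_trans; [apply (term_le_window a (S N)); auto; lia | apply HB]. }
  specialize (Ha (- Z.of_nat N - 1)%Z). lra.
Qed.

Lemma window_shift_vanishing a N :
  a (- Z.of_nat N - 1)%Z = 0 -> a (Z.of_nat N + 1)%Z = 0 ->
  window N (fun n => a (n + 1)%Z) = window N a.
Proof.
  intros H0 H1. unfold window. rewrite block_shift.
  replace (- Z.of_nat N - 1 + Z.of_nat (2 * N + 2))%Z with (Z.of_nat N + 1)%Z by lia.
  rewrite H0, H1. ring.
Qed.

Lemma cutoff_lo N : cutoff N (- Z.of_nat N - 1) = 0.
Proof. apply cutoff_end; lia. Qed.

Lemma cutoff_hi N : cutoff N (Z.of_nat N + 1) = 0.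
Proof. apply cutoff_end; lia. Qed.

Lemma inv_INR_pos N : 0 < / (INR N + 1) <= 1.
Proof.
  pose proof (pos_INR N). split; [apply Rinv_0_lt_compat; lra|].
  rewrite <- Rinv_1. apply Rinv_le_contravar; lra.
Qed.

Lemma window_neighbours_le u B N :
  (forall N, window N (fun n => Cmod (u n) ^ 2) <= B) ->
  window N (fun n => Cmod (u n) * Cmod (u (n + 1)%Z)) <= 2 * B.
Proof.
  intros HB.
  pose proof (window_shift_le _ B N (pow2_Cmod_ge_0 u) HB) as Hs. cbv beta in Hs.
  pose proof (HB N) as H0.
  assert (0 <= window N (fun n => Cmod (u n) ^ 2)) by (apply block_pos, pow2_Cmod_ge_0).
  apply Rle_trans with (window N (fun n =>
    / 2 * (Cmod (u n) ^ 2 + Cmod (u (n + 1)%Z) ^ 2))).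
  - apply block_le. intros n _. pose proof (pow2_ge_0 (Cmod (u n) - Cmod (u (n + 1)%Z))). nra.
  - unfold window in *. rewrite block_scal, block_plus. lra.
Qed.

Lemma energy_cutoff_le N v u :
  (forall n, 0 <= v n) ->
  energy N (fun n => cutoff N n * v n) u <= window N (fun n => v n * Cmod (u n) ^ 2).
Proof.
  intros Hv. apply block_le. intros n _.
  pose proof (cutoff_bounds N n). specialize (Hv n). pose proof (pow2_Cmod_ge_0 u n).
  rewrite Rmult_assoc. assert (0 <= v n * Cmod (u n) ^ 2) by (apply Rmult_le_pos; auto). nra.
Qed.

(* [sqrt (E + e^2)] is differentiated in place of [sqrt E], which may vanish. *)
Lemma flow_l2_growth h rho q z T B (G g : R -> R) :
  0 < h -> 0 < T -> schrodinger_flow h rho q z -> in_l2 (z 0) ->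
  (forall s N, 0 < s <= T -> window N (fun n => Cmod (z s n) ^ 2) <= B) ->
  (forall s, 0 < s <= T -> is_derive G s (g s)) ->
  right_continuous_0 G ->
  (forall s, 0 < s <= T -> 0 <= g s) ->
  (forall s N e, 0 < s <= T -> 0 <= e -> energy N (cutoff N) (z s) <= e ^ 2 ->
     window N (fun n => cutoff N n * (Cmod (z s n) * Cmod (q s n))) <= g s * e) ->
  l2norm 1 (z T) <= l2norm 1 (z 0) + (G T - G 0).
Proof.
  intros Hh HT Hz H0 HB HG HG0 Hg Hq.
  set (Y := l2norm 1 (z 0)).
  assert (HY : 0 <= Y) by apply l2norm_ge_0.
  assert (HGT : 0 <= G T - G 0).
  { enough (- G T <= - G 0) by lra.
    apply (nonincreasing_from_0 (fun s => - G s) (fun s => - g s)); auto.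
    - intros x Hx. apply (is_derive_opp G x (g x)). auto.
    - intros x Hx. specialize (Hg x Hx). lra.
    - apply (right_continuous_0_comp G Ropp HG0).
      apply (ex_derive_continuous Ropp). auto_derive; auto. }
  assert (HB0 : 0 <= B).
  { eapply Rle_trans; [|apply (HB T O); lra]. apply block_pos, pow2_Cmod_ge_0. }
  assert (HH : 0 < 2 / h ^ 2) by (apply Rdiv_lt_0_compat; [lra | apply pow_lt; lra]).
  apply l2norm1_le; [lra|]. intros m.
  apply sqr_le_of_le_add; auto. intros e He.
  (* The slope of the cutoff contributes at most [2 / h ^ 2 * (k * (2 * B))] to the derivative of
     the energy; division by [2 * sqrt (E + e ^ 2) >= 2 * e] leaves [D * k]. *)
  set (D := 2 / h ^ 2 * B / e).
  assert (HD : 0 <= D).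
  { apply Rdiv_le_0_compat; auto. apply Rmult_le_pos; lra. }
  set (Q := Y + (G T - G 0) + e).
  (* These are the coefficients in the expansion of [(Q + D * T * k) ^ 2], with [k ^ 2] bounded by
     [k]. *)
  apply (cutoff_limit (fun n => Cmod (z T n) ^ 2) (Q ^ 2) (2 * Q * (D * T) + (D * T) ^ 2)).
  { apply pow2_Cmod_ge_0. }
  intros N. set (k := / (INR N + 1)).
  assert (Hk : 0 < k <= 1) by apply inv_INR_pos.
  set (E := fun s => energy N (cutoff N) (z s)).
  assert (HE : forall s, 0 <= E s).
  { intros s. apply block_pos. intros n.
    apply Rmult_le_pos; [apply cutoff_bounds | apply pow2_Cmod_ge_0]. }
  assert (He2 : 0 < e ^ 2) by (apply pow_lt; lra).
  set (dE := fun s =>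
    2 / h ^ 2 * window N (fun n => (cutoff N (n + 1) - cutoff N n) * cross (z s n) (z s (n + 1)%Z))
     + 2 * window N (fun n => cutoff N n * cross (z s n) (q s n))).
  assert (Hs : forall s, 0 < sqrt (E s + e ^ 2)).
  { intros s. apply sqrt_lt_R0. specialize (HE s). lra. }
  assert (K : sqrt (E T + e ^ 2) - G T - D * k * T <= sqrt (E 0 + e ^ 2) - G 0 - D * k * 0).
  { apply (nonincreasing_from_0 (fun s => sqrt (E s + e ^ 2) - G s - D * k * s)
      (fun s => dE s / (2 * sqrt (E s + e ^ 2)) - g s - D * k)); auto.
    - intros s Hx. specialize (HE s).
      apply (is_derive_minus (fun s => sqrt (E s + e ^ 2) - G s) (fun s => D * k * s) s
               (dE s / (2 * sqrt (E s + e ^ 2)) - g s) (D * k)).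
      + apply (is_derive_minus (fun s => sqrt (E s + e ^ 2)) G); auto.
        apply (is_derive_sqrt (fun s => E s + e ^ 2)); [|lra].
        replace (dE s) with (plus (dE s) zero) by apply plus_zero_r.
        apply (is_derive_plus E (fun _ => e ^ 2)); [|apply (is_derive_const (e ^ 2))].
        apply (is_derive_energy h rho q z s N (cutoff N)); auto; try lra;
          [apply cutoff_lo | apply cutoff_hi].
      + auto_derive; [auto | ring].
    - intros s Hx.
      assert (dE s <= 2 / h ^ 2 * (k * (2 * B)) + 2 * (g s * sqrt (E s + e ^ 2))).
      { apply Rplus_le_compat; apply Rmult_le_compat_l; try lra.
        - apply Rle_trans with (window N (fun n => k * (Cmod (z s n) * Cmod (z s (n + 1)%Z)))).
          + apply block_le. intros n _. eapply Rle_trans; [apply Rle_abs|].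
            rewrite Rabs_mult. apply Rmult_le_compat; try apply Rabs_pos.
            * apply cutoff_step.
            * apply Rabs_cross_le.
          + unfold window. rewrite block_scal. apply Rmult_le_compat_l; [lra|].
            apply (window_neighbours_le (z s)). intros; apply HB; lra.
        (* The source hypothesis is used with [sqrt (E s + e ^ 2)] as the bound for the root of the
           energy. *)
        - eapply Rle_trans; [|apply (Hq s N)]; try lra.
          + apply block_le. intros n _. apply Rmult_le_compat_l;
              [apply cutoff_bounds | apply cross_le].
          + apply sqrt_pos.
          + rewrite pow2_sqrt; fold (E s); specialize (HE s); lra. }
      specialize (Hs s).
      assert (Hse : e <= sqrt (E s + e ^ 2)).
      { rewrite <- (sqrt_pow2 e) at 1 by lra. apply sqrt_le_1_alt. specialize (HE s). lra. }
      set (S := sqrt (E s + e ^ 2)) in *.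
      assert (dE s / (2 * S) <= g s + D * k).
      { apply (Rmult_le_reg_r (2 * S)); [lra|].
        replace (dE s / (2 * S) * (2 * S)) with (dE s) by (field; lra).
        assert (D * k * (2 * e) <= D * k * (2 * S)).
        { apply Rmult_le_compat_l; [apply Rmult_le_pos; lra | lra]. }
        replace (D * k * (2 * e)) with (2 / h ^ 2 * (k * (2 * B))) in *
          by (unfold D; field; lra). lra. }
      lra.
    - apply right_continuous_0_plus; [apply right_continuous_0_plus|].
      + apply (right_continuous_0_comp (fun s => E s + e ^ 2) sqrt);
          [|apply continuous_sqrt].
        apply right_continuous_0_plus; [|apply filterlim_const].
        now apply (right_continuous_0_energy h rho q).
      + apply (right_continuous_0_comp G Ropp HG0).
        apply (ex_derive_continuous Ropp). auto_derive; auto.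
      + apply (ex_derive_right_continuous_0 (fun s => - (D * k * s))). auto_derive; auto. }
  assert (E0 : E 0 <= Y ^ 2).
  { eapply Rle_trans; [|apply (window_le_l2norm1 _ N H0)].
    apply block_le. intros n _. pose proof (cutoff_bounds N n).
    pose proof (pow2_Cmod_ge_0 (z 0) n). nra. }
  assert (S0 : sqrt (E 0 + e ^ 2) <= Y + e).
  { rewrite <- (sqrt_pow2 (Y + e)) by lra. apply sqrt_le_1_alt. nra. }
  assert (ST : E T <= (Q + D * T * k) ^ 2).
  { apply Rle_trans with (sqrt (E T + e ^ 2) ^ 2).
    - rewrite pow2_sqrt; specialize (HE T); lra.
    - specialize (Hs T). apply pow_incr. unfold Q. lra. }
  change (E T <= Q ^ 2 + (2 * Q * (D * T) + (D * T) ^ 2) * k).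
  assert (0 <= (D * T) ^ 2) by apply pow2_ge_0.
  assert (k * k <= k) by nra.
  nra.
Qed.

Lemma exp_le_compat x y : x <= y -> exp x <= exp y.
Proof. intros [L | ->]; [left; now apply exp_increasing | right; reflexivity]. Qed.

(** A weight [w] on bonds controlled by a weight [v] on sites. With the increment of [v] as [w] it
    measures the hopping term, with [v] or its shift the nearest-neighbour source. *)
Definition neighbour_dominated (v w : Z -> R) (gam : R) : Prop :=
  forall n a b, 0 <= a -> 0 <= b ->
    w n * (a * b) <= gam * (v n * a ^ 2 + v (n + 1)%Z * b ^ 2).

(** Each site ends two bonds, so the energy appears twice. [th] stands for the cutoff at either end
    of the bond; moving it to the other end costs [/ (INR N + 1)], and the 3 is 1 for the window
    plus 2 for its shift. *)
Lemma window_cutoff_neighbours v Rv (u : Z -> C) (w th : Z -> R) gam B N :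
  (forall n, 0 <= v n <= Rv) ->
  0 <= gam ->
  neighbour_dominated v w gam ->
  (forall N, window N (fun n => Cmod (u n) ^ 2) <= B) ->
  (forall n, 0 <= th n) ->
  (forall n, th n <= cutoff N n + / (INR N + 1)) ->
  (forall n, th n <= cutoff N (n + 1) + / (INR N + 1)) ->
  window N (fun n => th n * (w n * (Cmod (u n) * Cmod (u (n + 1)%Z)))) <=
  gam * (2 * energy N (fun n => cutoff N n * v n) u + 3 * Rv * B / (INR N + 1)).
Proof.
  intros v_bounds Hgam Hw HB Ht Ht0 Ht1. unfold Rdiv. set (k := / (INR N + 1)) in *.
  assert (Hk : 0 < k <= 1) by apply inv_INR_pos.
  set (f := fun n => cutoff N n * v n * Cmod (u n) ^ 2).
  set (p := fun n => Cmod (u n) ^ 2).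
  assert (Ef : energy N (fun n => cutoff N n * v n) u = window N f) by reflexivity.
  rewrite Ef.
  apply Rle_trans with (window N (fun n => gam * ((f n + f (n + 1)%Z)
    + (k * Rv) * (p n + p (n + 1)%Z)))).
  - apply block_le. intros n _.
    pose proof (Cmod_ge_0 (u n)). pose proof (Cmod_ge_0 (u (n + 1)%Z)).
    apply Rle_trans with (th n * (gam * (v n * Cmod (u n) ^ 2
      + v (n + 1)%Z * Cmod (u (n + 1)%Z) ^ 2))).
    + apply Rmult_le_compat_l; auto.
    + replace (th n * (gam * (v n * Cmod (u n) ^ 2 + v (n + 1)%Z * Cmod (u (n + 1)%Z) ^ 2)))
        with (gam * (th n * (v n * p n) + th n * (v (n + 1)%Z * p (n + 1)%Z)))
        by (unfold p; ring).
      apply Rmult_le_compat_l; auto.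
      assert (A : forall j, th n <= cutoff N j + k ->
        th n * (v j * p j) <= f j + k * Rv * p j).
      { intros j Hj. pose proof (v_bounds j) as [v0 v1].
        assert (Pj : 0 <= p j) by apply pow2_Cmod_ge_0.
        assert (0 <= v j * p j) by (apply Rmult_le_pos; auto).
        assert (v j * p j <= Rv * p j) by (apply Rmult_le_compat_r; auto).
        assert (th n * (v j * p j) <= (cutoff N j + k) * (v j * p j))
          by (apply Rmult_le_compat_r; auto).
        unfold f. fold (p j). nra. }
      pose proof (A n (Ht0 n)). pose proof (A (n + 1)%Z (Ht1 n)). lra.
  - unfold window. rewrite block_scal, block_plus, block_scal, !block_plus.
    fold (window N f). fold (window N p).
    change (block (fun n => f (n + 1)%Z) (- Z.of_nat N - 1) (2 * N + 2))
      with (window N (fun n => f (n + 1)%Z)).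
    change (block (fun n => p (n + 1)%Z) (- Z.of_nat N - 1) (2 * N + 2))
      with (window N (fun n => p (n + 1)%Z)).
    rewrite (window_shift_vanishing f)
      by (unfold f; rewrite ?cutoff_lo, ?cutoff_hi; ring).
    pose proof (window_shift_le p B N (pow2_Cmod_ge_0 u) HB).
    pose proof (HB N) as HN. fold p in HN.
    assert (0 <= Rv) by (pose proof (v_bounds 0%Z); lra).
    apply Rmult_le_compat_l; auto.
    assert (k * Rv * (window N p + window N (fun n => p (n + 1)%Z)) <= k * Rv * (3 * B)).
    { apply Rmult_le_compat_l; [apply Rmult_le_pos; lra | lra]. }
    lra.
Qed.

(** Gronwall's inequality for the cutoff energy. The bound [Rv] on the weight enters only the cutoff
    error, not the final rate, so the truncation can later be removed. *)
Lemma flow_weighted_growth v Rv h rho q z T B alpha beta kappa W :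
  (forall n, 0 <= v n <= Rv) ->
  0 < h -> 0 < T -> 0 <= alpha -> 0 <= beta -> 0 <= kappa ->
  schrodinger_flow h rho q z ->
  (forall s N, 0 < s <= T -> window N (fun n => Cmod (z s n) ^ 2) <= B) ->
  (forall s n, 0 < s <= T ->
     Cmod (q s n) <= kappa * (Cmod (z s (n + 1)%Z) + Cmod (z s (n - 1)%Z))) ->
  neighbour_dominated v (fun n => Rabs (v (n + 1)%Z - v n)) alpha ->
  neighbour_dominated v v beta ->
  neighbour_dominated v (fun n => v (n + 1)%Z) beta ->
  (forall N, window N (fun n => v n * Cmod (z 0 n) ^ 2) <= W) ->
  forall m, window m (fun n => v n * Cmod (z T n) ^ 2) <=
    exp ((4 * alpha / h ^ 2 + 8 * kappa * beta) * T) * W.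
Proof.
  intros v_bounds Hh HT Ha Hb Hka Hz HB Hq Nd Nv Nv1 HW.
  set (lam := 4 * alpha / h ^ 2 + 8 * kappa * beta).
  assert (HR : 0 <= Rv) by (pose proof (v_bounds 0%Z); lra).
  assert (HB0 : 0 <= B).
  { eapply Rle_trans; [|apply (HB T O); lra]. apply block_pos, pow2_Cmod_ge_0. }
  assert (HH : 0 < 2 / h ^ 2) by (apply Rdiv_lt_0_compat; [lra | apply pow_lt; lra]).
  assert (Hlam : 0 <= lam).
  { unfold lam. replace (4 * alpha / h ^ 2) with (2 / h ^ 2 * (2 * alpha)) by (field; lra).
    apply Rplus_le_le_0_compat; repeat apply Rmult_le_pos; lra. }
  (* [D] collects the coefficients of [k] in the bound [HdE] for the derivative of the energy. *)
  set (D := 2 / h ^ 2 * (alpha * (3 * Rv * B) + Rv * (2 * B)) + 4 * kappa * beta * (3 * Rv * B)).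
  assert (HD : 0 <= D).
  { unfold D. repeat first [apply Rplus_le_le_0_compat | apply Rmult_le_pos]; lra. }
  apply (cutoff_limit _ _ (exp (lam * T) * (D * T))).
  { intros n. apply Rmult_le_pos; [apply v_bounds | apply pow2_Cmod_ge_0]. }
  intros N. unfold Rdiv. set (k := / (INR N + 1)).
  assert (Hk : 0 < k <= 1) by apply inv_INR_pos.
  set (V := fun n => cutoff N n * v n).
  set (E := fun s => energy N V (z s)).
  set (dE := fun s =>
    2 / h ^ 2 * window N (fun n => (V (n + 1)%Z - V n) * cross (z s n) (z s (n + 1)%Z))
     + 2 * window N (fun n => V n * cross (z s n) (q s n))).
  assert (V0 : V (- Z.of_nat N - 1)%Z = 0) by (unfold V; rewrite cutoff_lo; ring).
  assert (V1 : V (Z.of_nat N + 1)%Z = 0) by (unfold V; rewrite cutoff_hi; ring).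
  assert (cut_step : forall n, - k <= cutoff N (n + 1) - cutoff N n <= k).
  { intros n. pose proof (cutoff_step N n) as S. fold k in S.
    unfold Rabs in S. destruct Rcase_abs in S; lra. }
  assert (HdE : forall s, 0 < s <= T -> dE s <= lam * E s + D * k).
  { intros s Hs.
    assert (HBs : forall N, window N (fun n => Cmod (z s n) ^ 2) <= B) by (intros; apply HB; auto).
    set (P := fun n => Cmod (z s n) * Cmod (z s (n + 1)%Z)).
    assert (HP : forall n, 0 <= P n) by (intros; apply Rmult_le_pos; apply Cmod_ge_0).
    assert (C0 : forall w gam, 0 <= gam -> neighbour_dominated v w gam ->
       window N (fun n => cutoff N n * (w n * P n)) <= gam * (2 * E s + 3 * Rv * B * k)).
    { intros w gam Hg Hw. apply window_cutoff_neighbours; auto; fold k; intros n;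
        pose proof (cutoff_bounds N n); pose proof (cut_step n); lra. }
    assert (C1 : forall w gam, 0 <= gam -> neighbour_dominated v w gam ->
       window N (fun n => cutoff N (n + 1) * (w n * P n)) <= gam * (2 * E s + 3 * Rv * B * k)).
    { intros w gam Hg Hw. apply (window_cutoff_neighbours v Rv (z s) w (fun n => cutoff N (n + 1)));
        auto; fold k; intros n;
        pose proof (cutoff_bounds N (n + 1)); pose proof (cut_step n); lra. }
    assert (I1 : window N (fun n => (V (n + 1)%Z - V n) * cross (z s n) (z s (n + 1)%Z))
       <= alpha * (2 * E s + 3 * Rv * B * k) + k * Rv * (2 * B)).
    { apply Rle_trans with (window N (fun n =>
        cutoff N n * (Rabs (v (n + 1)%Z - v n) * P n) + k * Rv * P n)).
      - apply block_le. intros n _. eapply Rle_trans; [apply Rle_abs|].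
        rewrite Rabs_mult.
        pose proof (Rabs_cross_le (z s n) (z s (n + 1)%Z)) as X. fold (P n) in X.
        assert (Rabs (V (n + 1)%Z - V n) <= cutoff N n * Rabs (v (n + 1)%Z - v n) + k * Rv).
        (* Discrete product rule: the increment of [v] feeds the rate, that of the cutoff only the
           error. *)
        { unfold V. replace (cutoff N (n + 1) * v (n + 1)%Z - cutoff N n * v n) with
            (cutoff N n * (v (n + 1)%Z - v n) + (cutoff N (n + 1) - cutoff N n) * v (n + 1)%Z)
            by ring.
          eapply Rle_trans; [apply Rabs_triang|]. rewrite !Rabs_mult.
          pose proof (cutoff_bounds N n). pose proof (v_bounds (n + 1)%Z).
          rewrite (Rabs_pos_eq (cutoff N n)), (Rabs_pos_eq (v (n + 1)%Z)) by lra.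
          apply Rplus_le_compat_l. apply Rmult_le_compat; try lra; [apply Rabs_pos|].
          apply cutoff_step. }
        apply Rle_trans with ((cutoff N n * Rabs (v (n + 1)%Z - v n) + k * Rv) * P n).
        + apply Rmult_le_compat; auto; apply Rabs_pos.
        + right; ring.
      - unfold window. rewrite block_plus, block_scal.
        apply Rplus_le_compat; [apply (C0 _ alpha); auto|].
        apply Rmult_le_compat_l; [apply Rmult_le_pos; lra|].
        apply (window_neighbours_le (z s)); auto. }
    assert (I2 : window N (fun n => V n * cross (z s n) (q s n))
       <= kappa * (2 * (beta * (2 * E s + 3 * Rv * B * k)))).
    (* Terms with the left neighbour are shifted to the bond (n, n+1), where cutoff and weight then
       sit at the right end. *)
    { set (b := fun n => V n * (Cmod (z s n) * Cmod (z s (n - 1)%Z))).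
      apply Rle_trans with (window N (fun n =>
        kappa * (cutoff N n * (v n * P n) + b n))).
      - apply block_le. intros n _.
        apply Rle_trans with (V n * (Cmod (z s n) * Cmod (q s n))).
        + apply Rmult_le_compat_l; [|apply cross_le].
          apply Rmult_le_pos; [apply cutoff_bounds | apply v_bounds].
        + replace (kappa * (cutoff N n * (v n * P n) + b n)) with
            (V n * (Cmod (z s n) * (kappa * (Cmod (z s (n + 1)%Z) + Cmod (z s (n - 1)%Z)))))
            by (unfold b, P, V; ring).
          apply Rmult_le_compat_l;
            [apply Rmult_le_pos; [apply cutoff_bounds | apply v_bounds]|].
          apply Rmult_le_compat_l; [apply Cmod_ge_0 | auto].
      - unfold window. rewrite block_scal, block_plus.
        apply Rmult_le_compat_l; auto.
        fold (window N (fun n => cutoff N n * (v n * P n))). fold (window N b).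
        rewrite <- (window_shift_vanishing b)
          by (unfold b; rewrite ?V0, ?V1; ring).
        replace (window N (fun n => b (n + 1)%Z))
          with (window N (fun n => cutoff N (n + 1) * (v (n + 1)%Z * P n))).
        + pose proof (C0 _ _ Hb Nv). pose proof (C1 _ _ Hb Nv1). lra.
        + apply block_ext. intros n. unfold b, V, P.
          replace (n + 1 - 1)%Z with n by lia. ring. }
    unfold dE.
    apply Rle_trans with (2 / h ^ 2 * (alpha * (2 * E s + 3 * Rv * B * k) + k * Rv * (2 * B))
      + 2 * (kappa * (2 * (beta * (2 * E s + 3 * Rv * B * k))))).
    - apply Rplus_le_compat; apply Rmult_le_compat_l; lra.
    - right. unfold lam, D. field. lra. }
  (* Integrating factor; as [exp (- lam * s) <= 1], the error [D * k] passes through unamplified. *)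
  assert (K : exp (- lam * T) * E T - D * k * T <= exp (- lam * 0) * E 0 - D * k * 0).
  { apply (nonincreasing_from_0 (fun s => exp (- lam * s) * E s - D * k * s)
      (fun s => ((- lam * 1) * exp (- lam * s) * E s + exp (- lam * s) * dE s) - D * k)); auto.
    - intros s Hs.
      apply (is_derive_minus (fun s => exp (- lam * s) * E s) (fun s => D * k * s) s
        ((- lam * 1) * exp (- lam * s) * E s + exp (- lam * s) * dE s) (D * k)).
      + apply (is_derive_mult (fun s => exp (- lam * s)) E s); [| |intros; apply Rmult_comm].
        * auto_derive; [auto | ring].
        * apply (is_derive_energy h rho q z s N V); auto; lra.
      + auto_derive; [auto | ring].
    - intros s Hs. specialize (HdE s Hs).
      pose proof (exp_pos (- lam * s)).
      assert (exp (- lam * s) <= 1).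
      { rewrite <- exp_0. apply exp_le_compat. nra. }
      assert (0 <= D * k) by (apply Rmult_le_pos; lra). nra.
    - apply right_continuous_0_plus; [apply right_continuous_0_mult|].
      + apply (ex_derive_right_continuous_0 (fun s => exp (- lam * s))). auto_derive; auto.
      + now apply (right_continuous_0_energy h rho q).
      + apply (ex_derive_right_continuous_0 (fun s => - (D * k * s))). auto_derive; auto. }
  assert (E0 : E 0 <= W).
  { eapply Rle_trans; [apply energy_cutoff_le; apply v_bounds | apply HW]. }
  rewrite !Rmult_0_r, exp_0 in K.
  assert (X : exp (lam * T) * exp (- lam * T) = 1).
  { rewrite <- exp_plus, <- exp_0. f_equal. ring. }
  pose proof (exp_pos (lam * T)).
  replace (window N (fun n => cutoff N n * (v n * Cmod (z T n) ^ 2))) with (E T)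
    by (apply block_ext; intros; unfold V; ring).
  replace (E T) with (exp (lam * T) * (exp (- lam * T) * E T))
    by (rewrite <- Rmult_assoc, X; ring).
  replace (exp (lam * T) * W + exp (lam * T) * (D * T) * k)
    with (exp (lam * T) * (W + D * k * T)) by ring.
  apply Rmult_le_compat_l; lra.
Qed.

(** * The two lattices *)

Lemma lattice_solution_continuity h F u t e :
  0 < h -> is_lattice_solution h F u -> 0 <= t -> 0 < e ->
  exists d : R, 0 < d /\
    forall s, 0 <= s -> Rabs (s - t) < d -> l2norm 1 (csub (u s) (u t)) < e.
Proof.
  intros Hh [_ [H _]] Ht He.
  assert (Hr : 0 < sqrt h) by (apply sqrt_lt_R0; lra).
  assert (Hhe : 0 < sqrt h * e) by (apply Rmult_lt_0_compat; lra).
  destruct (H t Ht (ball 0 (mkposreal _ Hhe)) (locally_ball _ _)) as [d Hd].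
  exists d. split; [apply cond_pos|]. intros s Hs Hst.
  specialize (Hd s Hst Hs).
  unfold ball in Hd; simpl in Hd.
  unfold AbsRing_ball, abs, minus, plus, opp in Hd; simpl in Hd.
  apply Rabs_def2 in Hd. rewrite l2norm_scale in Hd by auto. nra.
Qed.

Lemma Cmod_le_l2norm1 u n : in_l2 u -> Cmod (u n) <= l2norm 1 u.
Proof.
  intros H.
  apply Rsqr_incr_0_var; [|apply l2norm_ge_0].
  rewrite !Rsqr_pow2. now apply Cmod_sqr_le_l2norm1.
Qed.

Lemma Rabs_Cmod_sub (a b : C) : Rabs (Cmod a - Cmod b) <= Cmod (a - b)%C.
Proof.
  apply Rabs_le.
  pose proof (Cmod_triangle (a - b) b) as H1.
  pose proof (Cmod_triangle (b - a) a) as H2.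
  replace (a - b + b)%C with a in H1 by ring.
  replace (b - a + a)%C with b in H2 by ring.
  replace (b - a)%C with (- (a - b))%C in H2 by ring. rewrite Cmod_opp in H2. lra.
Qed.

Lemma right_continuous_0_Cmod_sqr (u : R -> C) :
  (forall e, 0 < e -> exists d, 0 < d /\
     forall s, 0 <= s -> Rabs (s - 0) < d -> Cmod (u s - u 0)%C < e) ->
  right_continuous_0 (fun s => Cmod (u s) ^ 2).
Proof.
  intros H.
  apply (right_continuous_0_comp (fun s => Cmod (u s)) (fun x => x ^ 2));
    [|apply (ex_derive_continuous (fun x => x ^ 2)); auto_derive; auto].
  intros P [e He].
  destruct (H e (cond_pos e)) as [d [Hd Hs]].
  exists (mkposreal d Hd). intros s Bs Ls. apply He.
  unfold ball; simpl; unfold AbsRing_ball, abs, minus, plus, opp; simpl.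
  eapply Rle_lt_trans; [apply Rabs_Cmod_sub|]. apply Hs; [lra | exact Bs].
Qed.

Lemma lattice_solution_pointwise h F u n e :
  0 < h -> is_lattice_solution h F u -> 0 < e ->
  exists d, 0 < d /\
     forall s, 0 <= s -> Rabs (s - 0) < d -> Cmod (u s n - u 0 n)%C < e.
Proof.
  intros Hh Hu He.
  destruct (lattice_solution_continuity h F u 0 e Hh Hu (Rle_refl 0) He) as [d [Hd Hs]].
  exists d. split; auto. intros s H0 H1.
  eapply Rle_lt_trans; [|apply (Hs s H0 H1)].
  apply (Cmod_le_l2norm1 (csub (u s) (u 0)) n).
  destruct Hu as [Hu _]. apply csub_triangle; apply Hu; lra.
Qed.

(** Extreme value theorem on [0, T]; [Rmax 0 s] freezes the solution at negative times to obtain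
    two-sided continuity. It supplies the a priori bound for [DGPE_norm_le]. *)
Lemma lattice_solution_bounded h F u T :
  0 < h -> is_lattice_solution h F u -> 0 <= T ->
  exists B, forall s, 0 <= s <= T -> l2norm 1 (u s) <= B.
Proof.
  intros Hh Hu HT.
  destruct (continuity_ab_maj (fun s => l2norm 1 (u (Rmax 0 s))) 0 T HT) as [x [Hx _]].
  - intros c Hc. apply continuity_pt_locally. intros eps.
    destruct (lattice_solution_continuity h F u c eps Hh Hu (proj1 Hc) (cond_pos eps))
      as [d [Hd H]].
    exists (mkposreal d Hd). intros s Bs.
    rewrite (Rmax_right 0 c) by lra.
    assert (Hin : forall r, 0 <= r -> in_l2 (u r)) by apply Hu.
    pose proof (Rmax_l 0 s) as Hm.
    assert (D : l2norm 1 (csub (u (Rmax 0 s)) (u c)) < eps).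
    { apply H; auto. unfold ball in Bs; simpl in Bs.
      unfold AbsRing_ball, abs, minus, plus, opp in Bs; simpl in Bs.
      apply Rabs_def2 in Bs. apply Rabs_def1; unfold Rmax; destruct Rle_dec; lra. }
    pose proof (l2norm1_sub_le (u (Rmax 0 s)) (u c) (Hin _ Hm) (Hin _ (proj1 Hc))).
    pose proof (l2norm1_sub_le (u c) (u (Rmax 0 s)) (Hin _ (proj1 Hc)) (Hin _ Hm)) as H2.
    rewrite l2norm1_csub_sym in H2. apply Rabs_def1; lra.
  - exists (l2norm 1 (u (Rmax 0 x))). intros s Hs.
    rewrite <- (Rmax_right 0 s) by lra. apply Hx; auto.
Qed.

Definition potential (h Om g : R) (u : Z -> C) (n : Z) : R :=
  Om ^ 2 * (h * IZR n) ^ 2 + g * Cmod (u n) ^ 2.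

Lemma DGPE_flow h Om g phi :
  0 < h -> is_lattice_solution h (F_DGPE h Om g) phi ->
  schrodinger_flow h (fun t => potential h Om g (phi t)) (fun _ _ => 0%C) phi.
Proof.
  intros Hh Hphi. split.
  - intros t Ht n. destruct Hphi as [_ [_ [H _]]].
    destruct (H t Ht n) as [d [Hd E]]. exists d. split; auto.
    etransitivity; [|exact E]. unfold F_DGPE, potential. rewrite RtoC_plus. ring.
  - intros n. apply (right_continuous_0_Cmod_sqr (fun s => phi s n)). intros e He.
    now apply (lattice_solution_pointwise h (F_DGPE h Om g)).
Qed.

(** This nonlinearity involves the neighbours, so it is not a real multiple of u_n and has to be
    treated as a source. *)
Definition AL_coupling (mu : R) (u : Z -> C) (n : Z) : C :=
  (RtoC (mu * Cmod (u n) ^ 2) * (u (n + 1)%Z + u (n - 1)%Z))%C.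

Lemma Cmod_AL_coupling_le mu K u n :
  0 <= mu -> Cmod (u n) ^ 2 <= K ->
  Cmod (AL_coupling mu u n) <= mu * K * (Cmod (u (n + 1)%Z) + Cmod (u (n - 1)%Z)).
Proof.
  intros Hmu HK. unfold AL_coupling. rewrite Cmod_mult, Cmod_R.
  pose proof (pow2_Cmod_ge_0 u n).
  rewrite Rabs_pos_eq by (apply Rmult_le_pos; auto).
  apply Rmult_le_compat; [apply Rmult_le_pos; auto | apply Cmod_ge_0 | | apply Cmod_triangle].
  now apply Rmult_le_compat_l.
Qed.

Lemma AL_flow h mu psi :
  0 < h -> is_lattice_solution h (F_AL h mu) psi ->
  schrodinger_flow h (fun _ _ => 0) (fun t n => (- AL_coupling mu (psi t) n)%C) psi.
Proof.
  intros Hh Hpsi. split.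
  - intros t Ht n. destruct Hpsi as [_ [_ [H _]]].
    destruct (H t Ht n) as [d [Hd E]]. exists d. split; auto.
    etransitivity; [|exact E]. unfold F_AL, AL_coupling. ring.
  - intros n. apply (right_continuous_0_Cmod_sqr (fun s => psi s n)). intros e He.
    now apply (lattice_solution_pointwise h (F_AL h mu)).
Qed.

(* Splitting [g |phi|^2 phi = g |phi|^2 y + g |phi|^2 psi] puts the first part into the real
   potential, which does not affect [|y_n|]; only the part driven by [psi] remains as source. *)
Definition difference_source (h Om g mu : R) (phi psi : Z -> C) (n : Z) : C :=
  (RtoC (potential h Om g phi n) * psi n + AL_coupling mu psi n)%C.

Lemma difference_flow h Om g mu phi psi :
  0 < h -> is_lattice_solution h (F_DGPE h Om g) phi ->
  is_lattice_solution h (F_AL h mu) psi ->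
  schrodinger_flow h (fun t => potential h Om g (phi t))
    (fun t => difference_source h Om g mu (phi t) (psi t))
    (fun t => csub (phi t) (psi t)).
Proof.
  intros Hh Hphi Hpsi. split.
  - intros t Ht n.
    destruct (proj1 (DGPE_flow _ _ _ _ Hh Hphi) t Ht n) as [d1 [Hd1 E1]].
    destruct (proj1 (AL_flow _ _ _ Hh Hpsi) t Ht n) as [d2 [Hd2 E2]].
    exists (d1 - d2)%C. split.
    + exact (is_derive_minus _ _ _ _ _ Hd1 Hd2).
    + match type of E1 with ?a = _ => match type of E2 with ?b = _ =>
        transitivity (a - b)%C end end; [|rewrite E1, E2; ring].
      unfold difference_source, dlap, csub. ring.
  - intros n. apply (right_continuous_0_Cmod_sqr (fun s => csub (phi s) (psi s) n)).
    intros e He.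
    destruct (lattice_solution_pointwise _ _ _ n (e / 2) Hh Hphi ltac:(lra)) as [d1 [P1 H1]].
    destruct (lattice_solution_pointwise _ _ _ n (e / 2) Hh Hpsi ltac:(lra)) as [d2 [P2 H2]].
    exists (Rmin d1 d2). split; [now apply Rmin_glb_lt|]. intros s Hs Hd.
    pose proof (Rmin_l d1 d2). pose proof (Rmin_r d1 d2).
    specialize (H1 s Hs ltac:(lra)). specialize (H2 s Hs ltac:(lra)).
    unfold csub.
    replace (phi s n - psi s n - (phi 0 n - psi 0 n))%C
      with ((phi s n - phi 0 n) + - (psi s n - psi 0 n))%C by ring.
    eapply Rle_lt_trans; [apply Cmod_triangle|]. rewrite Cmod_opp. lra.
Qed.

(** One half of mass conservation: trap and cubic term form a real potential, and without a source
    [flow_l2_growth] applies with [G = 0]. *)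
Lemma DGPE_norm_le h Om g phi t :
  0 < h -> is_lattice_solution h (F_DGPE h Om g) phi -> 0 < t ->
  l2norm 1 (phi t) <= l2norm 1 (phi 0).
Proof.
  intros Hh Hphi Ht.
  destruct (lattice_solution_bounded _ _ _ t Hh Hphi ltac:(lra)) as [B HB].
  assert (Hin : forall r, 0 <= r -> in_l2 (phi r)) by apply Hphi.
  replace (l2norm 1 (phi 0)) with (l2norm 1 (phi 0) + (0 - 0)) by ring.
  apply (flow_l2_growth h _ _ phi t (B ^ 2) (fun _ => 0) (fun _ => 0) Hh Ht
    (DGPE_flow _ _ _ _ Hh Hphi)).
  - apply Hin; lra.
  - intros s N Hs. eapply Rle_trans; [apply window_le_l2norm1, Hin; lra|].
    apply pow_incr. split; [apply l2norm_ge_0 | apply HB; lra].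
  - intros. apply (is_derive_const 0).
  - apply filterlim_const.
  - intros; lra.
  - intros s N e Hs He _. unfold window. rewrite (block_ext _ (fun n => 0 * 0)).
    + rewrite block_scal. lra.
    + intros n. rewrite Cmod_0. ring.
Qed.

(** * The weight and the weighted norm of the Ablowitz-Ladik solution *)

Lemma wgt_ge_1 h n : 1 <= wgt h n.
Proof.
  unfold wgt. pose proof (pow2_ge_0 (h * IZR n)). set (x := (h * IZR n) ^ 2) in *. nra.
Qed.

Lemma wgt_opp h n : wgt h (- n) = wgt h n.
Proof. unfold wgt. rewrite opp_IZR. ring. Qed.

(** An explicit ratio for use in the nonlinear term, since the constants of the theorem are fixed
    before [c1] is given. *)
Lemma wgt_step h n : wgt h n <= (2 * (1 + h ^ 2)) ^ 2 * wgt h (n + 1).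
Proof.
  unfold wgt. rewrite <- Rpow_mult_distr. apply pow_incr. rewrite plus_IZR.
  replace (h * (IZR n + 1)) with (h * IZR n + h) by ring.
  set (x := h * IZR n). pose proof (pow2_ge_0 x).
  split; [lra|].
  (* Before squaring, the right side minus the left is [1 + (x + 2 * h) ^ 2 + 2 * (h * (x + h)) ^
     2]. *)
  pose proof (pow2_ge_0 (x + 2 * h)). pose proof (pow2_ge_0 (h * (x + h))). nra.
Qed.

(** The weight is even, so the hypothesis at -(n+1) is the reversed inequality. *)
Lemma wgt_step_sym h c :
  (forall n, wgt h n <= c * wgt h (n + 1)) ->
  forall n, wgt h (n + 1) <= c * wgt h n.
Proof.
  intros H n. specialize (H (- (n + 1))%Z). rewrite wgt_opp in H.
  replace (- (n + 1) + 1)%Z with (- n)%Z in H by lia. now rewrite wgt_opp in H.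
Qed.

Lemma wgt_ratio_ge_1 h c : (forall n, wgt h n <= c * wgt h (n + 1)) -> 1 <= c.
Proof.
  intros H. specialize (H (-1)%Z). pose proof (wgt_ge_1 h (-1)).
  replace (wgt h (-1 + 1)) with 1 in H; [lra|]. unfold wgt. simpl. ring.
Qed.

Definition truncated_wgt (h Rv : R) (n : Z) : R := Rmin (wgt h n) Rv.

Lemma truncated_wgt_bounds h Rv n : 0 <= Rv -> 0 <= truncated_wgt h Rv n <= Rv.
Proof.
  intros H. split; [|apply Rmin_r]. apply Rmin_glb; auto. pose proof (wgt_ge_1 h n). lra.
Qed.

(** Truncation keeps the ratio because [c >= 1], which follows by comparing the sites -1 and 0. *)
Lemma truncated_wgt_step h Rv c :
  0 <= Rv -> (forall n, wgt h n <= c * wgt h (n + 1)) ->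
  forall n, truncated_wgt h Rv n <= c * truncated_wgt h Rv (n + 1) /\
            truncated_wgt h Rv (n + 1) <= c * truncated_wgt h Rv n.
Proof.
  intros HR H n. pose proof (wgt_ratio_ge_1 h c H).
  pose proof (H n). pose proof (wgt_step_sym h c H n).
  unfold truncated_wgt, Rmin. split; repeat destruct Rle_dec; nra.
Qed.

(** AM-GM balanced between two weights of ratio r^2: the constant is linear in [r], which is why the
    linear growth rate contains [sqrt c1] and not [c1]. *)
Lemma amgm_weighted r m x y a b :
  0 < r -> 0 <= m -> m <= y -> m <= r ^ 2 * x -> 0 <= a -> 0 <= b ->
  m * (a * b) <= r / 2 * (x * a ^ 2 + y * b ^ 2).
Proof.
  intros Hr Hm Hy Hx Ha Hb.
  assert (m / r ^ 2 <= x).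
  { apply (Rmult_le_reg_l (r ^ 2)); [apply pow_lt; lra|].
    replace (r ^ 2 * (m / r ^ 2)) with m by (field; lra). lra. }
  apply Rle_trans with (r / 2 * (m / r ^ 2 * a ^ 2 + m * b ^ 2)).
  - replace (r / 2 * (m / r ^ 2 * a ^ 2 + m * b ^ 2))
      with (m * (a * b) + m * r / 2 * (a / r - b) ^ 2) by (field; lra).
    assert (0 <= m * r / 2 * (a / r - b) ^ 2).
    { apply Rmult_le_pos; [nra | apply pow2_ge_0]. }
    lra.
  - apply Rmult_le_compat_l; [lra|].
    pose proof (pow2_ge_0 a). pose proof (pow2_ge_0 b).
    apply Rplus_le_compat; apply Rmult_le_compat_r; auto.
Qed.

Lemma wgt_mono h n m : (Z.abs n <= m)%Z -> wgt h n <= wgt h m.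
Proof.
  intros H. unfold wgt. rewrite !Rpow_mult_distr.
  assert (IZR n ^ 2 <= IZR m ^ 2).
  { rewrite <- !Rsqr_pow2. apply neg_pos_Rsqr_le; rewrite <- ?opp_IZR; apply IZR_le; lia. }
  pose proof (pow2_ge_0 h). pose proof (pow2_ge_0 (IZR n)).
  apply pow_incr. split; [|apply Rplus_le_compat_l, Rmult_le_compat_l; auto].
  assert (0 <= h ^ 2 * IZR n ^ 2) by (apply Rmult_le_pos; auto). lra.
Qed.

Lemma AL_weighted_growth h mu psi c1 K t W :
  0 < h -> 0 < mu -> 0 < c1 -> (forall n, wgt h n <= c1 * wgt h (n + 1)) ->
  is_lattice_solution h (F_AL h mu) psi ->
  (forall s, 0 < s -> l2norm 1 (psi s) ^ 2 <= K) -> 0 < t ->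
  (forall N, window N (fun n => wgt h n * Cmod (psi 0 n) ^ 2) <= W) ->
  forall m, window m (fun n => wgt h n * Cmod (psi t n) ^ 2) <=
    exp ((2 * sqrt c1 / h ^ 2 + 8 * mu * K * (1 + h ^ 2)) * t) * W.
Proof.
  intros Hh Hmu Hc1 Hc Hpsi HK Ht HW m.
  assert (Hin : forall r, 0 <= r -> in_l2 (psi r)) by apply Hpsi.
  assert (HK0 : 0 <= K).
  { eapply Rle_trans; [apply pow2_ge_0 | apply (HK 1); lra]. }
  (* The truncation level depends on the window: on the sites from -m-1 to m the truncated weight is
     still [wgt]. *)
  set (Rv := wgt h (Z.of_nat m + 1)).
  assert (HR : 0 <= Rv) by (pose proof (wgt_ge_1 h (Z.of_nat m + 1)); unfold Rv; lra).
  set (v := truncated_wgt h Rv).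
  assert (Hv : forall n, 0 <= v n <= Rv) by (intros; now apply truncated_wgt_bounds).
  assert (Hr : 0 < sqrt c1) by now apply sqrt_lt_R0.
  pose proof (pow2_ge_0 h).
  apply Rle_trans with (window m (fun n => v n * Cmod (psi t n) ^ 2)).
  { apply block_le. intros n Hn. apply Rmult_le_compat_r; [apply pow2_Cmod_ge_0|].
    apply Rmin_glb; [lra|]. apply wgt_mono. lia. }
  replace (2 * sqrt c1 / h ^ 2 + 8 * mu * K * (1 + h ^ 2))
    with (4 * (sqrt c1 / 2) / h ^ 2 + 8 * (mu * K) * (2 * (1 + h ^ 2) / 2)) by (field; lra).
  apply (flow_weighted_growth v Rv h (fun _ _ => 0)
    (fun t n => (- AL_coupling mu (psi t) n)%C) psi t K); auto; try lra.
  - apply Rmult_le_pos; lra.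
  - now apply AL_flow.
  - intros s N Hs. eapply Rle_trans; [apply window_le_l2norm1, Hin; lra | apply HK; lra].
  - intros s n Hs. rewrite Cmod_opp. apply Cmod_AL_coupling_le; [lra|].
    eapply Rle_trans; [apply Cmod_sqr_le_l2norm1, Hin; lra | apply HK; lra].
  - intros n a b Ha Hb.
    destruct (truncated_wgt_step h Rv c1 HR Hc n) as [S1 S2]. fold v in S1, S2.
    pose proof (Hv n). pose proof (Hv (n + 1)%Z).
    assert (E2 : sqrt c1 ^ 2 = c1) by (apply pow2_sqrt; lra).
    (* The site of larger weight plays the role of [y] in [amgm_weighted]; in the second case the
       two sites are exchanged. *)
    destruct (Rle_or_lt (v n) (v (n + 1)%Z)).
    + rewrite Rabs_pos_eq by lra.
      apply amgm_weighted; rewrite ?E2; lra.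
    + rewrite Rabs_left by lra. rewrite (Rmult_comm a b), (Rplus_comm (v n * a ^ 2)).
      apply amgm_weighted; rewrite ?E2; lra.
  - intros n a b Ha Hb.
    destruct (truncated_wgt_step h Rv _ HR (wgt_step h) n) as [S1 S2]. fold v in S1, S2.
    pose proof (Hv n). rewrite (Rmult_comm a b), (Rplus_comm (v n * a ^ 2)).
    apply amgm_weighted; lra.
  - intros n a b Ha Hb.
    destruct (truncated_wgt_step h Rv _ HR (wgt_step h) n) as [S1 S2]. fold v in S1, S2.
    pose proof (Hv (n + 1)%Z).
    apply amgm_weighted; lra.
  - intros N. eapply Rle_trans; [|apply (HW N)].
    apply block_le. intros n _. apply Rmult_le_compat_r; [apply pow2_Cmod_ge_0 | apply Rmin_l].
Qed.

(** * Growth of the difference of the two solutions *)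

Lemma window_shift_back_le a B N :
  (forall n, 0 <= a n) -> (forall N, window N a <= B) ->
  window N (fun n => a (n - 1)%Z) <= 2 * B.
Proof.
  intros Ha HB. unfold window.
  pose proof (block_shift (fun n => a (n - 1)%Z) (- Z.of_nat N - 1) (2 * N + 2)) as E.
  cbv beta in E. rewrite (block_ext _ a) in E by (intros; f_equal; lia).
  pose proof (HB N) as H1. unfold window in H1.
  assert (a (- Z.of_nat N - 1 - 1)%Z <= B).
  { eapply Rle_trans; [apply (term_le_window a (S (S N))); auto; lia | apply HB]. }
  specialize (Ha (- Z.of_nat N - 1 + Z.of_nat (2 * N + 2) - 1)%Z). lra.
Qed.

Lemma window_cutoff_CS N (u : Z -> C) (x : Z -> R) e X :
  0 <= e -> 0 <= X -> energy N (cutoff N) u <= e ^ 2 ->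
  window N (fun n => x n ^ 2) <= X ^ 2 ->
  window N (fun n => cutoff N n * (Cmod (u n) * x n)) <= X * e.
Proof.
  intros He HX Hu Hx. rewrite Rmult_comm. apply block_CS; auto.
  - intros n; apply cutoff_bounds.
  - eapply Rle_trans; [|exact Hx]. apply block_le. intros n _.
    pose proof (cutoff_bounds N n). pose proof (pow2_ge_0 (x n)). nra.
Qed.

(** The trap factor is at most [1 + (h * IZR n) ^ 2], the root of the weight, which gives [X]. In
    the cubic terms two factors are bounded pointwise by [P ^ 2] or [L ^ 2]; the 4 is two neighbours
    times a factor 2 per shift. *)
Lemma window_difference_source h Om g mu phi psi y N e P L X :
  0 <= mu -> 0 <= e -> 0 <= P -> 0 <= L -> 0 <= X ->
  in_l2 phi -> l2norm 1 phi <= P -> in_l2 psi -> l2norm 1 psi <= L ->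
  (forall N, window N (fun n => wgt h n * Cmod (psi n) ^ 2) <= X ^ 2) ->
  energy N (cutoff N) y <= e ^ 2 ->
  window N (fun n => cutoff N n * (Cmod (y n) * Cmod (difference_source h Om g mu phi psi n)))
    <= (Om ^ 2 * X + (Rabs g * P ^ 2 * L + 4 * mu * L ^ 3)) * e.
Proof.
  intros Hmu He HP HL HX Iphi Hphi Ipsi Hpsi Hw Hy.
  assert (HpsiN : forall N, window N (fun n => Cmod (psi n) ^ 2) <= L ^ 2).
  { intros M. eapply Rle_trans; [apply window_le_l2norm1; auto|].
    apply pow_incr. split; [apply l2norm_ge_0 | auto]. }
  assert (Hpsi2 : forall n, Cmod (psi n) ^ 2 <= L ^ 2).
  { intros n. eapply Rle_trans; [apply Cmod_sqr_le_l2norm1; auto|].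
    apply pow_incr. split; [apply l2norm_ge_0 | auto]. }
  assert (Hphi2 : forall n, Cmod (phi n) ^ 2 <= P ^ 2).
  { intros n. eapply Rle_trans; [apply Cmod_sqr_le_l2norm1; auto|].
    apply pow_incr. split; [apply l2norm_ge_0 | auto]. }
  pose proof (pow2_ge_0 Om). pose proof (Rabs_pos g). pose proof (pow2_ge_0 P).
  assert (HmL : 0 <= mu * L ^ 2) by (apply Rmult_le_pos; [lra | apply pow2_ge_0]).
  apply Rle_trans with (window N (fun n =>
    Om ^ 2 * (cutoff N n * (Cmod (y n) * ((1 + (h * IZR n) ^ 2) * Cmod (psi n))))
    + ((Rabs g * P ^ 2) * (cutoff N n * (Cmod (y n) * Cmod (psi n)))
    + (mu * L ^ 2) * (cutoff N n * (Cmod (y n) * Cmod (psi (n + 1)%Z))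
                    + cutoff N n * (Cmod (y n) * Cmod (psi (n - 1)%Z)))))).
  - apply block_le. intros n _.
    set (bd := Om ^ 2 * ((1 + (h * IZR n) ^ 2) * Cmod (psi n)) + ((Rabs g * P ^ 2) * Cmod (psi n)
       + (mu * L ^ 2) * (Cmod (psi (n + 1)%Z) + Cmod (psi (n - 1)%Z)))).
    apply Rle_trans with (cutoff N n * (Cmod (y n) * bd)).
    + apply Rmult_le_compat_l; [apply cutoff_bounds|].
      apply Rmult_le_compat_l; [apply Cmod_ge_0|].
      unfold difference_source, bd. eapply Rle_trans; [apply Cmod_triangle|].
      rewrite <- Rplus_assoc. apply Rplus_le_compat.
      * rewrite Cmod_mult, Cmod_R. rewrite <- Rmult_assoc, <- Rmult_plus_distr_r.
        apply Rmult_le_compat_r; [apply Cmod_ge_0|]. unfold potential.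
        eapply Rle_trans; [apply Rabs_triang|]. rewrite !Rabs_mult.
        pose proof (pow2_ge_0 (h * IZR n)).
        rewrite (Rabs_pos_eq (Om ^ 2)), (Rabs_pos_eq ((h * IZR n) ^ 2)),
          (Rabs_pos_eq (Cmod (phi n) ^ 2)) by (auto; apply pow2_ge_0).
        apply Rplus_le_compat; apply Rmult_le_compat_l; auto; lra.
      * now apply Cmod_AL_coupling_le.
    + right. unfold bd. ring.
  - assert (I1 : window N (fun n =>
      cutoff N n * (Cmod (y n) * ((1 + (h * IZR n) ^ 2) * Cmod (psi n)))) <= X * e).
    { apply window_cutoff_CS; auto.
      eapply Rle_trans; [|apply (Hw N)]. right. apply block_ext. intros n. unfold wgt. ring. }
    assert (I2 : window N (fun n => cutoff N n * (Cmod (y n) * Cmod (psi n))) <= L * e)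
      by (apply window_cutoff_CS; auto).
    assert (I3 : window N (fun n => cutoff N n * (Cmod (y n) * Cmod (psi (n + 1)%Z)))
      <= 2 * L * e).
    { apply window_cutoff_CS; auto; [lra|].
      pose proof (window_shift_le _ _ N (pow2_Cmod_ge_0 psi) HpsiN). cbv beta in *.
      pose proof (pow2_ge_0 L). lra. }
    assert (I4 : window N (fun n => cutoff N n * (Cmod (y n) * Cmod (psi (n - 1)%Z)))
      <= 2 * L * e).
    { apply window_cutoff_CS; auto; [lra|].
      pose proof (window_shift_back_le _ _ N (pow2_Cmod_ge_0 psi) HpsiN). cbv beta in *.
      pose proof (pow2_ge_0 L). lra. }
    unfold window in *. rewrite block_plus, block_plus, !block_scal, block_plus.
    apply Rle_trans with (Om ^ 2 * (X * e) + ((Rabs g * P ^ 2) * (L * e)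
      + (mu * L ^ 2) * (2 * L * e + 2 * L * e))); [|right; ring].
    apply Rplus_le_compat; [|apply Rplus_le_compat]; apply Rmult_le_compat_l; auto.
    + apply Rmult_le_pos; auto.
    + lra.
Qed.

Lemma difference_growth h Om g mu c1 gam phi psi L X t :
  0 < h -> 0 < mu -> 0 < c1 -> (forall n, wgt h n <= c1 * wgt h (n + 1)) ->
  is_lattice_solution h (F_DGPE h Om g) phi -> is_lattice_solution h (F_AL h mu) psi ->
  0 <= L -> (forall s, 0 < s -> l2norm 1 (psi s) <= L) ->
  0 <= X -> (forall N, window N (fun n => wgt h n * Cmod (psi 0 n) ^ 2) <= X ^ 2) ->
  0 < t -> 8 * mu * L ^ 2 * (1 + h ^ 2) * t <= 1 ->
  2 * sqrt c1 / h ^ 2 <= gam ->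
  l2norm 1 (csub (phi t) (psi t)) <= l2norm 1 (csub (phi 0) (psi 0))
    + (Om ^ 2 * X / gam * exp (gam * t)
       + (Rabs g * l2norm 1 (phi 0) ^ 2 * L + 4 * mu * L ^ 3) * t).
Proof.
  intros Hh Hmu Hc1 Hc Hphi Hpsi HL HpsiL HX HpsiX Ht Hshort Hgam.
  assert (Iphi : forall r, 0 <= r -> in_l2 (phi r)) by apply Hphi.
  assert (Ipsi : forall r, 0 <= r -> in_l2 (psi r)) by apply Hpsi.
  set (P := l2norm 1 (phi 0)).
  assert (HP : 0 <= P) by apply l2norm_ge_0.
  assert (Hr : 0 < sqrt c1) by now apply sqrt_lt_R0.
  assert (Hh2 : 0 < h ^ 2) by (apply pow_lt; lra).
  assert (Hgam0 : 0 < gam).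
  { eapply Rlt_le_trans; [|exact Hgam]. apply Rdiv_lt_0_compat; lra. }
  set (A := Rabs g * P ^ 2 * L + 4 * mu * L ^ 3).
  assert (HA : 0 <= A).
  { unfold A. pose proof (Rabs_pos g).
    apply Rplus_le_le_0_compat; repeat apply Rmult_le_pos; try lra; try apply pow_le; lra. }
  pose proof (pow2_ge_0 Om) as HOm.
  assert (HphiP : forall s, 0 < s -> l2norm 1 (phi s) <= P)
    by (intros; now apply (DGPE_norm_le h Om g)).
  pose proof (pow2_ge_0 L) as HL2.
  (* The squared weighted norm grows at rate at most [gam] up to a factor [exp 1 <= 4], hence the
     norm at rate [gam / 2] up to a factor 2. *)
  assert (Hweight : forall s, 0 < s <= t -> forall N,
     window N (fun n => wgt h n * Cmod (psi s n) ^ 2) <= (2 * X * exp (gam / 2 * s)) ^ 2).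
  { intros s Hs N.
    eapply Rle_trans; [apply (AL_weighted_growth h mu psi c1 (L ^ 2) s (X ^ 2)); auto; try lra|].
    - intros r Hr'. apply pow_incr. split; [apply l2norm_ge_0 | auto].
    - replace ((2 * X * exp (gam / 2 * s)) ^ 2) with (4 * exp (gam * s) * X ^ 2).
      + apply Rmult_le_compat_r; [apply pow2_ge_0|].
        apply Rle_trans with (exp (gam * s + 1)).
        * apply exp_le_compat.
          assert (2 * sqrt c1 / h ^ 2 * s <= gam * s) by (apply Rmult_le_compat_r; lra).
          assert (8 * mu * L ^ 2 * (1 + h ^ 2) * s <= 8 * mu * L ^ 2 * (1 + h ^ 2) * t).
          { apply Rmult_le_compat_l; [|lra].
            apply Rmult_le_pos; [apply Rmult_le_pos|]; lra. }
          lra.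
        * rewrite exp_plus. pose proof exp_le_3. pose proof (exp_pos (gam * s)). nra.
      + rewrite !Rpow_mult_distr. replace (exp (gam * s)) with (exp (gam / 2 * s) ^ 2); [ring|].
        simpl. rewrite Rmult_1_r, <- exp_plus. f_equal. field. }
  set (G := fun s => 4 * Om ^ 2 * X / gam * exp (gam / 2 * s) + A * s).
  set (Gp := fun s => Om ^ 2 * (2 * X * exp (gam / 2 * s)) + A).
  assert (Main : l2norm 1 (csub (phi t) (psi t)) <=
    l2norm 1 (csub (phi 0) (psi 0)) + (G t - G 0)).
  { apply (flow_l2_growth h _ _ (fun s => csub (phi s) (psi s)) t ((P + L) ^ 2) G Gp Hh Ht
      (difference_flow h Om g mu phi psi Hh Hphi Hpsi)).
    - apply csub_triangle; [apply Iphi | apply Ipsi]; lra.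
    - intros s N Hs.
      destruct (csub_triangle (phi s) (psi s)) as [I1 I2];
        [apply Iphi; lra | apply Ipsi; lra |].
      eapply Rle_trans; [apply window_le_l2norm1, I1|].
      apply pow_incr. split; [apply l2norm_ge_0|].
      specialize (HphiP s (proj1 Hs)). specialize (HpsiL s (proj1 Hs)). lra.
    - intros s Hs. unfold G, Gp. auto_derive; [auto | field; lra].
    - apply ex_derive_right_continuous_0. unfold G. auto_derive; auto.
    - intros s Hs. unfold Gp. apply Rplus_le_le_0_compat; auto.
      pose proof (exp_pos (gam / 2 * s)).
      apply Rmult_le_pos; auto. apply Rmult_le_pos; lra.
    - intros s N e Hs He HE.
      apply (window_difference_source h Om g mu (phi s) (psi s) (csub (phi s) (psi s))
        N e P L); auto; try lra.
      + pose proof (exp_pos (gam / 2 * s)). repeat apply Rmult_le_pos; lra.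
      + apply Iphi; lra.
      + apply HphiP; lra.
      + apply Ipsi; lra.
      + apply HpsiL; lra. }
  assert (HB : 0 <= Om ^ 2 * X / gam) by (apply Rdiv_le_0_compat; [apply Rmult_le_pos|]; lra).
  (* [4 (z - 1) <= z ^ 2] with [z = exp (gam t / 2)] *)
  assert (Hz : G t - G 0 <= Om ^ 2 * X / gam * exp (gam * t) + A * t).
  { unfold G. rewrite !Rmult_0_r, exp_0.
    replace (exp (gam * t)) with (exp (gam / 2 * t) ^ 2)
      by (simpl; rewrite Rmult_1_r, <- exp_plus; f_equal; field).
    set (z := exp (gam / 2 * t)). unfold Rdiv in *.
    replace (4 * Om ^ 2 * X * / gam) with (4 * (Om ^ 2 * X * / gam)) by ring.
    pose proof (pow2_ge_0 (z - 2)). nra. }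
  lra.
Qed.

(** * The growing and the uniform bound *)

Theorem mainTheorem4 :
  forall (h Om g mu M : R),
    0 < h -> g < 0 -> 0 < mu -> 0 < M ->
    exists Cmu Cstar : R, 0 < Cmu /\ 0 < Cstar /\
    forall (c1 : R) (phi psi : R -> Z -> C),
      0 < c1 -> (forall n : Z, wgt h n <= c1 * wgt h (n + 1)%Z) ->
      is_lattice_solution h (F_DGPE h Om g) phi ->
      is_lattice_solution h (F_AL h mu) psi ->
      in_l2w h (psi 0) ->
      (forall t, 0 < t -> (l2norm h (psi t)) ^ 2 <= M * (l2norm h (psi 0)) ^ 2) ->
      let y := fun t => csub (phi t) (psi t) in
      let Gam := Gamma_rate h mu c1 M (psi 0) in
      let A1 := Rabs g * (l2norm h (phi 0)) ^ 3
                + 2 * mu * Cmu * (l2norm h (psi 0)) ^ 3 in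
      let A2 := Om ^ 2 / Gam * l2wnorm h (psi 0) in
      (forall t, 0 <= t ->
         l2norm h (y t) <= l2norm h (y 0) + A1 * t + A2 * exp (Gam * t)) /\
      (forall t, 0 < t ->
         l2norm h (y t) <= l2norm h (phi 0) + Cstar * l2norm h (psi 0)).
Proof.
  intros h Om g mu M Hh Hg Hmu HM.
  assert (HsM : 0 < sqrt M) by now apply sqrt_lt_R0.
  assert (EM : sqrt M ^ 2 = M) by (apply pow2_sqrt; lra).
  assert (Hh2 : 0 < h ^ 2) by (apply pow_lt; lra).
  (* With this [kap], the factor [h] kept by cubic terms after division by [sqrt h] can be extracted
     from the DGPE source. *)
  set (kap := sqrt M / h).
  assert (Hkap : 0 < kap) by now apply Rdiv_lt_0_compat.
  pose proof (Rabs_pos g) as Hag.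
  (* Chosen so that [2 * mu * Clong * h * Q ^ 3 * t] is [(1 + sqrt M) * Q] times the quantity
     compared with 1 in the short-time condition. *)
  set (Clong := 4 * (1 + sqrt M) * M * (1 + h ^ 2) / h).
  assert (HClong : 0 < Clong).
  { apply Rdiv_lt_0_compat; [|lra]. repeat apply Rmult_lt_0_compat; lra. }
  (* The first summand pays for the [(kap * Q) ^ 3] left by the DGPE source, the second for the AL
     source. *)
  set (Cshort := Rabs g * kap ^ 3 / (2 * mu) + 2 * sqrt M ^ 3 / h).
  assert (HCshort : 0 < Cshort).
  { apply Rplus_le_lt_0_compat.
    - apply Rdiv_le_0_compat; [|lra]. apply Rmult_le_pos; auto. apply pow_le; lra.
    - apply Rdiv_lt_0_compat; [|lra]. apply Rmult_lt_0_compat; [lra | now apply pow_lt]. }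
  exists (Cshort + Clong), (sqrt M). split; [lra|]. split; [lra|].
  intros c1 phi psi Hc1 Hc Hphi Hpsi Hw HMpsi y Gam A1 A2.
  assert (Iphi : forall r, 0 <= r -> in_l2 (phi r)) by apply Hphi.
  assert (Ipsi : forall r, 0 <= r -> in_l2 (psi r)) by apply Hpsi.
  assert (Hsh : 0 < sqrt h) by now apply sqrt_lt_R0.
  assert (Esh : sqrt h ^ 2 = h) by (apply pow2_sqrt; lra).
  assert (Sc : forall u, l2norm h u = sqrt h * l2norm 1 u) by (intros; now apply l2norm_scale).
  set (P := l2norm 1 (phi 0)) in *. set (Q := l2norm 1 (psi 0)) in *.
  assert (HP : 0 <= P) by apply l2norm_ge_0.
  assert (HQ : 0 <= Q) by apply l2norm_ge_0.
  assert (HpsiL : forall s, 0 < s -> l2norm 1 (psi s) <= sqrt M * Q).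
  { intros s Hs. specialize (HMpsi s Hs). rewrite !Sc, !Rpow_mult_distr, Esh in HMpsi.
    apply Rsqr_incr_0_var; [|apply Rmult_le_pos; lra].
    rewrite !Rsqr_pow2, Rpow_mult_distr, EM.
    apply (Rmult_le_reg_l h); auto. fold Q in HMpsi. lra. }
  assert (HphiP : forall s, 0 < s -> l2norm 1 (phi s) <= P)
    by (intros; now apply (DGPE_norm_le h Om g)).
  assert (Hii : forall t, 0 < t -> l2norm 1 (y t) <= P + sqrt M * Q).
  { intros t Ht. destruct (csub_triangle (phi t) (psi t)) as [_ I];
      [apply Iphi; lra | apply Ipsi; lra |].
    specialize (HphiP t Ht). specialize (HpsiL t Ht). unfold y. lra. }
  set (X := l2wnorm h (psi 0) / sqrt h).
  assert (HX : 0 <= X) by (apply Rdiv_le_0_compat; [apply sqrt_pos | auto]).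
  assert (EX : l2wnorm h (psi 0) = sqrt h * X) by (unfold X; field; lra).
  assert (Wpos : forall n, 0 <= wgt h n * Cmod (psi 0 n) ^ 2).
  { intros n. apply Rmult_le_pos; [pose proof (wgt_ge_1 h n); lra | apply pow2_Cmod_ge_0]. }
  assert (HXW : forall N, window N (fun n => wgt h n * Cmod (psi 0 n) ^ 2) <= X ^ 2).
  { intros N. eapply Rle_trans; [now apply window_le_zsum|].
    unfold X, l2wnorm. rewrite sqrt_mult_alt by lra.
    replace (sqrt h * _ / sqrt h) with
      (sqrt (zsum (fun n => wgt h n * Cmod (psi 0 n) ^ 2))) by (field; lra).
    rewrite pow2_sqrt; [lra | now apply zsum_pos]. }
  assert (Hc1r : 0 < sqrt c1) by now apply sqrt_lt_R0.
  assert (HGam : 2 * sqrt c1 / h ^ 2 <= Gam).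
  { unfold Gam, Gamma_rate.
    assert (sqrt c1 <= sqrt (1 + c1 + 2 * sqrt c1)) by (apply sqrt_le_1_alt; lra).
    assert (0 <= 2 * mu * M * l2norm h (psi 0) ^ 2).
    { repeat apply Rmult_le_pos; try lra; apply l2norm_ge_0. }
    assert (2 * sqrt c1 / h ^ 2 <= 2 * sqrt (1 + c1 + 2 * sqrt c1) / h ^ 2).
    { apply Rmult_le_compat_r; [apply Rlt_le, Rinv_0_lt_compat|]; lra. }
    lra. }
  assert (HGam0 : 0 < Gam).
  { eapply Rlt_le_trans; [|exact HGam]. apply Rdiv_lt_0_compat; lra. }
  set (a1 := Rabs g * h * P ^ 3 + 2 * mu * (Cshort + Clong) * h * Q ^ 3).
  set (a2 := Om ^ 2 * X / Gam).
  assert (Ha2 : 0 <= a2)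
    by (apply Rdiv_le_0_compat; [apply Rmult_le_pos; [apply pow2_ge_0|]|]; lra).
  assert (Hshort : Rabs g * P ^ 2 * (sqrt M * Q) + 4 * mu * (sqrt M * Q) ^ 3
      <= Rabs g * h * P ^ 3 + 2 * mu * Cshort * h * Q ^ 3).
  (* The larger of [P] and [kap * Q] has a cube that alone dominates the product. *)
  { assert (kap * Q * P ^ 2 <= P ^ 3 + (kap * Q) ^ 3).
    { assert (0 <= kap * Q) by (apply Rmult_le_pos; lra).
      set (k := kap * Q) in *.
      destruct (Rle_or_lt k P).
      - assert (0 <= k ^ 3) by (apply pow_le; auto). pose proof (pow2_ge_0 P). nra.
      - assert (P * P <= k * k) by nra. assert (0 <= P ^ 3) by (apply pow_le; auto). nra. }
    replace (Rabs g * P ^ 2 * (sqrt M * Q)) with (Rabs g * h * (kap * Q * P ^ 2))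
      by (unfold kap; field; lra).
    replace (2 * mu * Cshort * h * Q ^ 3) with
      (Rabs g * h * (kap * Q) ^ 3 + 4 * mu * (sqrt M * Q) ^ 3)
      by (unfold Cshort; field; lra).
    assert (0 <= Rabs g * h) by (apply Rmult_le_pos; lra). nra. }
  assert (HQ3 : 0 <= 2 * mu * h * Q ^ 3).
  { assert (0 <= Q ^ 3) by now apply pow_le. repeat apply Rmult_le_pos; auto; lra. }
  assert (Hgh : 0 <= Rabs g * h * P ^ 3).
  { assert (0 <= P ^ 3) by now apply pow_le. repeat apply Rmult_le_pos; auto; lra. }
  assert (Hi : forall t, 0 < t -> l2norm 1 (y t) <=
    l2norm 1 (y 0) + a1 * t + a2 * exp (Gam * t)).
  { intros t Ht.
    assert (0 <= a2 * exp (Gam * t)).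
    { apply Rmult_le_pos; auto. apply Rlt_le, exp_pos. }
    destruct (Rle_or_lt (8 * mu * (sqrt M * Q) ^ 2 * (1 + h ^ 2) * t) 1) as [Hs | Hl].
    - pose proof (difference_growth h Om g mu c1 Gam phi psi (sqrt M * Q) X t
        Hh Hmu Hc1 Hc Hphi Hpsi ltac:(apply Rmult_le_pos; lra) HpsiL HX HXW Ht
        Hs HGam) as D.
      fold P in D. fold a2 in D.
      assert (A : (Rabs g * P ^ 2 * (sqrt M * Q) + 4 * mu * (sqrt M * Q) ^ 3) * t <= a1 * t).
      { apply Rmult_le_compat_r; [lra|]. unfold a1.
        assert (0 <= Clong * (2 * mu * h * Q ^ 3)) by (apply Rmult_le_pos; lra). lra. }
      unfold y. lra.
    (* Long times: since [P] is at most the initial difference plus [Q], the uniform bound exceeds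
       the initial difference by at most [(1 + sqrt M) * Q], which the linear term now covers. *)
    - pose proof (Hii t Ht) as U.
      pose proof (l2norm1_sub_le (phi 0) (psi 0) (Iphi 0 (Rle_refl 0)) (Ipsi 0 (Rle_refl 0)))
        as L. fold P in L. fold Q in L. fold (y 0) in L.
      assert ((1 + sqrt M) * Q <= 2 * mu * Clong * h * Q ^ 3 * t).
      { rewrite Rpow_mult_distr, EM in Hl.
        replace (2 * mu * Clong * h * Q ^ 3 * t) with
          ((1 + sqrt M) * Q * (8 * mu * (M * Q ^ 2) * (1 + h ^ 2) * t))
          by (unfold Clong; field; lra).
        rewrite <- (Rmult_1_r ((1 + sqrt M) * Q)) at 1.
        apply Rmult_le_compat_l; [apply Rmult_le_pos; lra | lra]. }
      assert (0 <= (Rabs g * h * P ^ 3 + Cshort * (2 * mu * h * Q ^ 3)) * t).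
      { apply Rmult_le_pos; [|lra]. apply Rplus_le_le_0_compat; auto.
        apply Rmult_le_pos; lra. }
      unfold a1. lra. }
  split.
  - intros t Ht.
    assert (E1 : A1 = sqrt h * a1).
    { unfold A1, a1. rewrite !Sc. fold P Q. rewrite !Rpow_mult_distr.
      replace (sqrt h ^ 3) with (sqrt h * sqrt h ^ 2) by ring. rewrite Esh. ring. }
    assert (E2 : A2 = sqrt h * a2) by (unfold A2, a2; rewrite EX; field; lra).
    rewrite E1, E2, !Sc.
    replace (_ + _) with (sqrt h * (l2norm 1 (y 0) + a1 * t + a2 * exp (Gam * t))) by ring.
    apply Rmult_le_compat_l; [lra|].
    (* At t = 0 the claim reduces to [0 <= a2]. *)
    destruct Ht as [Ht | <-]; [now apply Hi|].
    rewrite !Rmult_0_r, exp_0. lra.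
  - intros t Ht. rewrite !Sc. fold P Q.
    replace (sqrt h * P + sqrt M * (sqrt h * Q)) with (sqrt h * (P + sqrt M * Q)) by ring.
    apply Rmult_le_compat_l; [lra | now apply Hii].
Qed.
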